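(* Let $\mathbb{K}$ be a field of characteristic $0$, and let $\mathfrak g$ be a Lie algebra over $\mathbb{K}$ such that $(\Lambda^2\mathfrak g)^{\mathfrak g}=0$ and $\mathcal{Z}(\mathfrak g)=0$. Let $V$ be a $\mathbb{K}$-vector space of finite dimension $d\geq 1$, considered as an abelian Lie algebra. Assume that either $\dim V>1$ and $[\mathfrak g,\mathfrak g]=\mathfrak g$, or $\dim V=1$. Let $\mathfrak L=\mathfrak g\times V$. Then every Lie cobracket on $\mathfrak L$ is of the form $$\delta(x+v)=\delta_{\mathfrak g}(x)+2\sum_{i=1}^dD_i(x)\wedge t_i+\delta_V(v)\qquad(x\in\mathfrak g,\ v\in V),\qquad ( * )$$ where $\delta_{\mathfrak g}$ is a Lie bialgebra structure on $\mathfrak g$, $\delta_V$ is a Lie coalgebra structure on $V$, $\{t_i\}$ is a basis of $V$ with dual basis $\{t_i^*\}$, and $D_i=\mathbb D(t_i^* )$ for a Lie algebra map $\mathbb D\colon V^*\to\mathrm{BiDer}(\mathfrak g,\delta_{\mathfrak g})$. Explicitly, if $\delta$ defines a Lie bialgebra structure on $\mathfrak L$, then: 1. $\delta(V)\subseteq\Lambda^2(V)$, so $V$ is a Lie subcoalgebra with $\delta_V=\delta|_V$. In particular, $V$ is an ideal and a coideal; hence $\mathfrak L/V$ inherits a unique Lie bialgebra structure such that the projection $\pi\colon\mathfrak L\to\mathfrak L/V$ is a Lie bialgebra map. 2. Let $\pi_{\mathfrak g}\colon\mathfrak L\to\mathfrak g$ be the canonical projection associated to the decomposition $\mathfrak L=\mathfrak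 g\times V$. Then $\delta_{\mathfrak g}:=(\pi_{\mathfrak g}\wedge\pi_{\mathfrak g})\circ\delta|_{\mathfrak g}\colon\mathfrak g\to\Lambda^2\mathfrak g$ is a Lie bialgebra structure on $\mathfrak g$, and $\mathfrak L/V\cong\mathfrak g$ canonically as Lie bialgebras. 3. $\delta(\mathfrak g)\subseteq\Lambda^2\mathfrak g\oplus\mathfrak g\wedge V$. If $\{t_i\}_{i=1}^d$ is a basis of $V$, then for every $x\in\mathfrak g$, $\delta(x)$ is of the form $$\delta x=\delta_{\mathfrak g}x+2\sum_{i=1}^dD_ix\wedge t_i,$$ where $D_i\colon\mathfrak g\to\mathfrak g$, $i=1,\dots,d$, are derivations and coderivations of $(\mathfrak g,\delta_{\mathfrak g})$. The linear subspace generated by $\{D_1,\dots,D_d\}$ is a Lie subalgebra of $\mathrm{BiDer}(\mathfrak g)$; moreover, the map $\mathbb D\colon(V^*,\delta_V^* )\to\mathrm{BiDer}(\mathfrak g)$ defined by $\mathbb D(t_i^* )=D_i$ is a Lie algebra map. 4. Let $(\mathfrak L,\delta)$ be the Lie bialgebra given by $( * )$ from the data $(\delta_{\mathfrak g},\delta_V,D_1,\dots,D_d)$. Let $\Phi=(\phi_{\mathfrak g},\phi_V)$ be a linear automorphism of $\mathfrak L$ with $\phi_{\mathfrak g}$ a Lie algebra automorphism of $\mathfrak g$ and $\phi_V\in\mathrm{GL}(V)$. Put $\widetilde\delta_{\mathfrak g}=(\phi_{\mathfrak g}\wedge\phi_{\mathfrak g})\circ\delta_{\mathfrak g}\circ\phi_{\mathfrak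 g}^{-1}$, $\widetilde\delta_V=(\phi_V\wedge\phi_V)\circ\delta_V\circ\phi_V^{-1}$, and $\widetilde D_i:=\sum_{j=1}^dA_{ij}\,\phi_{\mathfrak g}\circ D_j\circ\phi_{\mathfrak g}^{-1}$, where $\phi_V(t_j)=\sum_{i=1}^dA_{ij}t_i$ for $1\le j\le d$, and let $(\mathfrak L,\widetilde\delta)$ be the Lie bialgebra given by $( * )$ from the data $(\widetilde\delta_{\mathfrak g},\widetilde\delta_V,\widetilde D_1,\dots,\widetilde D_d)$. Then $\Phi\colon(\mathfrak L,\delta)\to(\mathfrak L,\widetilde\delta)$ is a Lie bialgebra isomorphism. If, moreover, $[\mathfrak g,\mathfrak g]=\mathfrak g$, then any Lie bialgebra isomorphism between Lie bialgebra structures $(\mathfrak L,\delta)$ and $(\mathfrak L,\widetilde\delta)$ is of this form.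
   Context: $\mathcal Z(\mathfrak g)$ is the center and $(\Lambda^2\mathfrak g)^{\mathfrak g}$ the space of $\mathrm{ad}$-invariants. A Lie bialgebra over $\mathbb{K}$ is a Lie algebra $\mathfrak g$ with a linear map (Lie cobracket) $\delta\colon\mathfrak g\to\Lambda^2\mathfrak g$ which satisfies co-Jacobi ($\mathrm{Alt}((\delta\otimes \mathrm{id})\circ\delta)=0$, equivalently the degree-one derivation $\partial_\delta$ of $\Lambda^\bullet\mathfrak g$ extending $\delta$ satisfies $\partial_\delta^2=0$) and is a 1-cocycle: $\delta[x,y]=\mathrm{ad}_x\delta(y)-\mathrm{ad}_y\delta(x)$. A Lie coalgebra is a vector space $V$ with a linear map $\delta_V\colon V\to\Lambda^2V$ satisfying co-Jacobi. A coideal of $(\mathfrak L,\delta)$ is a subspace $I$ with $\delta(I)\subseteq I\wedge\mathfrak L$. A coderivation of $(\mathfrak g,\delta)$ is a linear map $D$ with $(D\otimes\mathrm{id}+\mathrm{id}\otimes D)\circ\delta=\delta\circ D$; a biderivation is a linear map that is both a derivation and a coderivation; $\mathrm{BiDer}(\mathfrak g)=\mathrm{BiDer}(\mathfrak g,\delta)$ is the Lie algebra of biderivations under the commutator. One has $\Lambda^2\mathfrak L=\Lambda^2\mathfrak g\oplus(\mathfrak g\wedge V)\oplus\Lambda^2V$. Normalization: $\Lambda^2\subset\otimes^2$ via $x\wedge y=\tfrac12(x\otimes y-y\otimes x)$; thus if $\delta_V(t_k)=\sum_{i,j}c_k^{ij}\,t_i\wedge t_j$ with $c_k^{ij}=-c_k^{ji}$,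 the bracket $\delta_V^*$ on $V^*$ is $[t_i^*,t_j^*]=\sum_k c_k^{ij}t_k^*$. *)

(* Defs.v *)
From HB Require Import structures.
From mathcomp Require Import all_boot all_order all_algebra.
From mathcomp Require Import ring.
From mathcomp Require Import boolp classical_sets functions.

Set Implicit Arguments.
Unset Strict Implicit.
Unset Printing Implicit Defensive.

Import GRing.Theory.
Local Open Scope classical_set_scope.
Local Open Scope quotient_scope.
Local Open Scope ring_scope.

(******************************************************************************)
(*           tensor U V == the tensor product of two vector spaces over K     *)
(*                         (of arbitrary dimension)                           *)
(*             tens x y == the pure tensor of x and y                         *)
(*          tens_lift f == the linear map on tensor U V induced by the        *)
(*                         bilinear map f                                     *)
(*         tens_map f h == the tensor product of the linear maps f and h      *)
(*            wedge x y == (tens x y - tens y x) / 2                          *)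
(*        wedge_sub A B == the subspace spanned by the wedge a b with a in A  *)
(*                         and b in B; Lambda2 U is wedge_sub setT setT       *)
(*           quotmod I  == the quotient of a vector space by a subspace       *)
(******************************************************************************)

Section Tensor.
Variables (K : fieldType) (U V : lmodType K).
Implicit Types (s : seq (U * V)) (a : K).

(* A list of pairs stands for the formal sum of its elements; scalars are     *)
(* absorbed in the first components.                                          *)
Inductive tens_eq : seq (U * V) -> seq (U * V) -> Prop :=
| TensRefl s : tens_eq s s
| TensSym s s' : tens_eq s s' -> tens_eq s' s
| TensTrans s s' s'' : tens_eq s s' -> tens_eq s' s'' -> tens_eq s s''
| TensCat s1 s1' s2 s2' : tens_eq s1 s1' -> tens_eq s2 s2' ->
    tens_eq (s1 ++ s2) (s1' ++ s2')
| TensCatC s1 s2 : tens_eq (s1 ++ s2) (s2 ++ s1)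
| TensDl x x' y : tens_eq [:: (x + x', y)] [:: (x, y); (x', y)]
| TensDr x y y' : tens_eq [:: (x, y + y')] [:: (x, y); (x, y')]
| TensZ a x y : tens_eq [:: (a *: x, y)] [:: (x, a *: y)]
| Tens0 y : tens_eq [:: (0, y)] [::].

Definition tens_eqb s s' : bool := `[< tens_eq s s' >].

Lemma tens_eqb_refl : reflexive tens_eqb.
Proof. by move=> s; apply/asboolP; exact: TensRefl. Qed.

Lemma tens_eqb_sym : symmetric tens_eqb.
Proof. by move=> s s'; apply/asboolP/asboolP => /TensSym. Qed.

Lemma tens_eqb_trans : transitive tens_eqb.
Proof.
by move=> s s' s'' /asboolP h /asboolP h'; apply/asboolP; exact: TensTrans h'.
Qed.

Canonical tens_equiv := EquivRel tens_eqb tens_eqb_refl tens_eqb_sym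
  tens_eqb_trans.

Definition tensor : Type := {eq_quot tens_eqb}.

HB.instance Definition _ : EqQuotient _ tens_eqb tensor :=
  EqQuotient.on tensor.
HB.instance Definition _ := Choice.on tensor.

Implicit Types t u : tensor.

Lemma tens_piP s s' : \pi_tensor s = \pi_tensor s' <-> tens_eq s s'.
Proof. by split=> [/eqmodP/asboolP //|h]; apply/eqmodP/asboolP. Qed.

Lemma tens_repr s : tens_eq (repr (\pi_tensor s)) s.
Proof. by apply/tens_piP; rewrite reprK. Qed.

Definition tens x y : tensor := \pi_tensor [:: (x, y)].

Definition tens_zero : tensor := \pi_tensor [::].
Definition tens_add t u : tensor := \pi_tensor (repr t ++ repr u).
Definition seq_scale a s := [seq (a *: p.1, p.2) | p <- s].
Definition tens_scale a t : tensor := \pi_tensor (seq_scale a (repr t)).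

Lemma seq_scale_eq a s s' :
  tens_eq s s' -> tens_eq (seq_scale a s) (seq_scale a s').
Proof.
elim=> {s s'} [s|s s' _ h|s s' s'' _ h _ h'|s1 s1' s2 s2' _ h _ h'|s1 s2
  |||b x y|y].
- exact: TensRefl.
- exact: TensSym.
- exact: TensTrans h'.
- by rewrite /seq_scale !map_cat; exact: TensCat.
- by rewrite /seq_scale !map_cat; exact: TensCatC.
- by move=> x x' y; rewrite /seq_scale /= scalerDr; exact: TensDl.
- by move=> x y y'; exact: TensDr.
- by rewrite /seq_scale /= scalerA mulrC -scalerA; exact: TensZ.
- by rewrite /seq_scale /= scaler0; exact: Tens0.
Qed.

Lemma tens_addE s s' :
  tens_add (\pi_tensor s) (\pi_tensor s') = \pi_tensor (s ++ s').
Proof. by apply/tens_piP; apply: TensCat; exact: tens_repr. Qed.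

Lemma tens_scaleE a s :
  tens_scale a (\pi_tensor s) = \pi_tensor (seq_scale a s).
Proof. by apply/tens_piP; apply: seq_scale_eq; exact: tens_repr. Qed.

Lemma tens_addA : associative tens_add.
Proof.
move=> t u v; rewrite -[t]reprK -[u]reprK -[v]reprK.
by rewrite (tens_addE (repr u)) (tens_addE (repr t) (repr u)) !tens_addE catA.
Qed.

Lemma tens_addC : commutative tens_add.
Proof.
move=> t u; rewrite -[t]reprK -[u]reprK !tens_addE.
by apply/tens_piP; exact: TensCatC.
Qed.

Lemma tens_add0 : left_id tens_zero tens_add.
Proof. by move=> t; rewrite -[t]reprK tens_addE. Qed.

Lemma seq_scaleDl a b s :
  tens_eq (seq_scale (a + b) s) (seq_scale a s ++ seq_scale b s).
Proof.
elim: s => [|[x y] s ih]; first exact: TensRefl.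
rewrite /= scalerDl.
apply: (@TensTrans _ ([:: (a *: x, y); (b *: x, y)] ++
                      (seq_scale a s ++ seq_scale b s))).
  exact: (@TensCat [:: _] _ _ _ (TensDl _ _ _) ih).
apply: (@TensCat [:: (a *: x, y)] [:: (a *: x, y)]
  ((b *: x, y) :: (seq_scale a s ++ seq_scale b s))
  (seq_scale a s ++ (b *: x, y) :: seq_scale b s)); first exact: TensRefl.
rewrite -[_ :: (_ ++ _)]cat1s -[_ :: seq_scale b s]cat1s !catA.
apply: TensCat (TensRefl _); exact: TensCatC.
Qed.

Lemma seq_scale0 s : tens_eq (seq_scale 0 s) [::].
Proof.
elim: s => [|[x y] s ih]; first exact: TensRefl.
by rewrite /= scale0r; exact: (@TensCat [:: _] [::] _ _ (Tens0 y) ih).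
Qed.

Lemma seq_scale1 s : seq_scale 1 s = s.
Proof. by elim: s => [//|[x y] s ih] /=; rewrite scale1r ih. Qed.

Lemma seq_scaleA a b s : seq_scale a (seq_scale b s) = seq_scale (a * b) s.
Proof. by elim: s => [//|[x y] s ih] /=; rewrite scalerA ih. Qed.

Lemma tens_addN : left_inverse tens_zero (tens_scale (-1)) tens_add.
Proof.
move=> t; rewrite -[t]reprK tens_scaleE tens_addE; apply/tens_piP.
rewrite -[X in _ ++ X]seq_scale1; apply: TensTrans (seq_scale0 (repr t)).
by rewrite -[0](addNr 1); apply: TensSym; exact: seq_scaleDl.
Qed.

HB.instance Definition _ := GRing.isZmodule.Build tensor
  tens_addA tens_addC tens_add0 tens_addN.

Lemma tens_scaleA a b t : tens_scale a (tens_scale b t) = tens_scale (a * b) t.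
Proof.
by rewrite -[t]reprK (tens_scaleE b) !tens_scaleE seq_scaleA.
Qed.

Lemma tens_scale1 : left_id 1 tens_scale.
Proof. by move=> t; rewrite -[t]reprK tens_scaleE seq_scale1. Qed.

Lemma tens_scaleDr : right_distributive tens_scale +%R.
Proof.
move=> a t u; rewrite -[t]reprK -[u]reprK.
by rewrite /GRing.add /= tens_addE !tens_scaleE tens_addE /seq_scale map_cat.
Qed.

Lemma tens_scaleDl t : {morph tens_scale^~ t : a b / a + b}.
Proof.
move=> a b; rewrite -[t]reprK !tens_scaleE [RHS]tens_addE.
by apply/tens_piP; exact: seq_scaleDl.
Qed.

HB.instance Definition _ := GRing.Zmodule_isLmodule.Build K tensor
  tens_scaleA tens_scale1 tens_scaleDr tens_scaleDl.

Lemma tens_bilinear : bilinear_for *:%R *:%R tens.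
Proof.
have tensZ a x y : a *: tens x y = tens (a *: x) y by exact: tens_scaleE.
have tensDl x x' y : tens (x + x') y = tens x y + tens x' y.
  by rewrite [RHS]tens_addE; apply/tens_piP; exact: TensDl.
have tensDr x y y' : tens x (y + y') = tens x y + tens x y'.
  by rewrite [RHS]tens_addE; apply/tens_piP; exact: TensDr.
split=> [y a x x'|x a y y'] /=; first by rewrite tensDl tensZ.
by rewrite tensDr tensZ; congr (_ + _); apply/tens_piP/TensSym; exact: TensZ.
Qed.

HB.instance Definition _ := bilinear_isBilinear.Build K U V tensor _ _ tens
  tens_bilinear.
HB.instance Definition _ x := GRing.isLinear.Build K V tensor _ (tens x)
  (tens_bilinear.2 x).

Lemma tens_piE s : \pi_tensor s = \sum_(p <- s) tens p.1 p.2.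
Proof.
elim: s => [|[x y] s ih]; first by rewrite big_nil.
by rewrite big_cons -ih; apply/esym; exact: tens_addE.
Qed.

Lemma tens_gen t : exists s, t = \sum_(p <- s) tens p.1 p.2.
Proof. by exists (repr t); rewrite -tens_piE reprK. Qed.

Section Lift.
Variables (W : lmodType K) (f : {bilinear U -> V -> W}).

Definition tens_lift t : W := \sum_(p <- repr t) f p.1 p.2.

Lemma tens_lift_eq s s' : tens_eq s s' ->
  \sum_(p <- s) f p.1 p.2 = \sum_(p <- s') f p.1 p.2.
Proof.
elim=> {s s'}.
- by [].
- by move=> s s' _ ->.
- by move=> s s' s'' _ -> _ ->.
- by move=> s1 s1' s2 s2' _ h _ h'; rewrite !big_cat h h'.
- by move=> s1 s2; rewrite !big_cat; exact: addrC.
- by move=> x x' y; rewrite !big_cons !big_nil /= linearDl !addr0.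
- by move=> x y y'; rewrite !big_cons !big_nil /= linearDr !addr0.
- by move=> a x y; rewrite !big_cons !big_nil /= linearZl linearZr.
- by move=> y; rewrite big_cons !big_nil /= linear0l addr0.
Qed.

Lemma tens_lift_pi s : tens_lift (\pi_tensor s) = \sum_(p <- s) f p.1 p.2.
Proof. by apply: tens_lift_eq; exact: tens_repr. Qed.

Lemma tens_lift_tens x y : tens_lift (tens x y) = f x y.
Proof. by rewrite tens_lift_pi big_seq1. Qed.

Lemma tens_lift_linear : linear tens_lift.
Proof.
move=> a t u; rewrite -[t]reprK -[u]reprK.
have -> : a *: \pi_tensor (repr t) + \pi_tensor (repr u) =
    \pi_tensor (seq_scale a (repr t) ++ repr u).
  by rewrite -tens_addE -tens_scaleE.
rewrite !tens_lift_pi big_cat big_map scaler_sumr; congr (_ + _).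
by apply: eq_bigr => p _; rewrite linearZl_LR.
Qed.

HB.instance Definition _ := GRing.isLinear.Build K tensor W _ tens_lift
  tens_lift_linear.

End Lift.

End Tensor.

Section TensorMaps.
Variable K : fieldType.

Section Map.
Variables (U U' V V' : lmodType K).
Variables (f : {linear U -> U'}) (h : {linear V -> V'}).

Definition tens_map2 (x : U) (y : V) : tensor U' V' := tens (f x) (h y).

Lemma tens_map2_bilinear : bilinear_for *:%R *:%R tens_map2.
Proof.
by split=> [y a x x'|x a y y']; rewrite /tens_map2 linearP ?linearPl ?linearPr.
Qed.

HB.instance Definition _ := bilinear_isBilinear.Build K U V (tensor U' V') _ _
  tens_map2 tens_map2_bilinear.

Definition tens_map : tensor U V -> tensor U' V' := tens_lift tens_map2.
HB.instance Definition _ := GRing.Linear.on tens_map.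

Lemma tens_mapE x y : tens_map (tens x y) = tens (f x) (h y).
Proof. exact: tens_lift_tens. Qed.

End Map.

Section Swap.
Variables U V : lmodType K.

Definition tens_rev (x : U) (y : V) : tensor V U := tens y x.

Lemma tens_rev_bilinear : bilinear_for *:%R *:%R tens_rev.
Proof.
by split=> [y a x x'|x a y y']; rewrite /tens_rev ?linearPl ?linearPr.
Qed.

HB.instance Definition _ := bilinear_isBilinear.Build K U V (tensor V U) _ _
  tens_rev tens_rev_bilinear.

Definition tens_swap : tensor U V -> tensor V U := tens_lift tens_rev.
HB.instance Definition _ := GRing.Linear.on tens_swap.

Lemma tens_swapE x y : tens_swap (tens x y) = tens y x.
Proof. exact: tens_lift_tens. Qed.

End Swap.

Section Contract.
Variables (U V : lmodType K) (f : {linear U -> K^o}) (h : {linear V -> K^o}).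

Definition contract2 (x : U) (y : V) : K^o := f x * h y.

Lemma contract2_bilinear : bilinear_for *:%R *:%R contract2.
Proof.
split=> [y a x x'|x a y y']; rewrite /contract2 linearP /=.
  by rewrite mulrDl -scalerAl.
by rewrite mulrDr -scalerAr.
Qed.

HB.instance Definition _ := bilinear_isBilinear.Build K U V K^o _ _ contract2
  contract2_bilinear.

Definition tens_contract : tensor U V -> K^o := tens_lift contract2.
HB.instance Definition _ := GRing.Linear.on tens_contract.

Lemma tens_contractE x y : tens_contract (tens x y) = f x * h y.
Proof. exact: tens_lift_tens. Qed.

End Contract.

Section Alt.
Variable U : lmodType K.
Local Notation T3 := (tensor (tensor U U) U).

Definition cyc2 (t : tensor U U) (z : U) : T3 := tens_map (tens z) idfun t.

Lemma cyc2Dr a t z z' : cyc2 t (a *: z + z') = a *: cyc2 t z + cyc2 t z'.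
Proof.
rewrite /cyc2; have [s ->] := tens_gen t.
rewrite !(linear_sum (tens_map _ _)) scaler_sumr -big_split.
by apply: eq_bigr => p _ /=; rewrite !tens_mapE /= !linearPl.
Qed.

Lemma cyc2_bilinear : bilinear_for *:%R *:%R cyc2.
Proof.
by split=> [z a t t'|t a z z']; [rewrite /cyc2 linearP|exact: cyc2Dr].
Qed.

HB.instance Definition _ := bilinear_isBilinear.Build K (tensor U U) U T3 _ _
  cyc2 cyc2_bilinear.

Definition cyc : T3 -> T3 := tens_lift cyc2.
HB.instance Definition _ := GRing.Linear.on cyc.

Lemma cycE x y z : cyc (tens (tens x y) z) = tens (tens z x) y.
Proof. by rewrite /cyc tens_lift_tens /= /cyc2 tens_mapE. Qed.

Definition Alt (t : T3) : T3 :=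
  let t' := tens_map (@tens_swap U U) idfun t in
  (t + cyc t + cyc (cyc t)) - (t' + cyc t' + cyc (cyc t')).

End Alt.

End TensorMaps.

Section Spans.
Variable K : fieldType.

Definition lspan (U : lmodType K) (A : set U) : set U :=
  [set x | exists n (c : 'I_n -> K) (u : 'I_n -> U),
     (forall i, A (u i)) /\ x = \sum_(i < n) c i *: u i].

Variable U : lmodType K.

Definition wedge (x y : U) : tensor U U := 2%:R^-1 *: (tens x y - tens y x).

Definition wedge_sub (A B : set U) : set (tensor U U) :=
  lspan [set wedge a b | a in A & b in B].

Definition Lambda2 : set (tensor U U) := wedge_sub setT setT.

End Spans.

Arguments Lambda2 {K} U.

Section QuotientModule.
Variables (K : fieldType) (L : lmodType K) (I : submodClosed L).

(* submodClosed does not inherit from zmodClosed, which Quotient.quot needs.  *)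
Definition as_zmod : L -> bool := fun x => x \in I.

Lemma as_zmod_closed : zmod_closed as_zmod.
Proof.
split=> [|x y]; first exact: (rpred0 I).
move=> Ix Iy; change (x - y \in I).
by rewrite -scaleN1r rpredD // rpredZ.
Qed.

Definition as_zmodClosed : zmodClosed L := HB.pack_for (zmodClosed L) as_zmod
  (GRing.isZmodClosed.Build L as_zmod as_zmod_closed).

Local Notation quot := (Quotient.quot as_zmodClosed).

Definition quotmod : Type := quot.

HB.instance Definition _ := GRing.Zmodule.on quotmod.

Definition quotmod_pi (x : L) : quotmod := \pi_quot x.

Lemma quotmod_piP x y : quotmod_pi x = quotmod_pi y <-> x - y \in I.
Proof.
have e : (x - y \in I) = (x == y %[mod quot]).
  exact: (Quotient.idealrBE as_zmodClosed).
by rewrite e; split=> /eqP.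
Qed.

Definition quotmod_scale (a : K) (q : quotmod) : quotmod :=
  quotmod_pi (a *: repr (q : quot)).

Lemma quotmod_ex q : exists x, q = quotmod_pi x.
Proof. by exists (repr (q : quot)); rewrite /quotmod_pi reprK. Qed.

Lemma quotmod_scaleE a x : quotmod_scale a (quotmod_pi x) = quotmod_pi (a *: x).
Proof.
apply/quotmod_piP; rewrite -scalerBr rpredZ //; apply/quotmod_piP.
by rewrite /quotmod_pi reprK.
Qed.

Lemma quotmod_piD x y : quotmod_pi (x + y) = quotmod_pi x + quotmod_pi y.
Proof. exact: (raddfD (\pi_quot)). Qed.

Lemma quotmod_scaleA a b q :
  quotmod_scale a (quotmod_scale b q) = quotmod_scale (a * b) q.
Proof. by have [x ->] := quotmod_ex q; rewrite !quotmod_scaleE scalerA. Qed.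

Lemma quotmod_scale1 : left_id 1 quotmod_scale.
Proof.
by move=> q; have [x ->] := quotmod_ex q; rewrite quotmod_scaleE scale1r.
Qed.

Lemma quotmod_scaleDr : right_distributive quotmod_scale +%R.
Proof.
move=> a q r; have [x ->] := quotmod_ex q; have [y ->] := quotmod_ex r.
by rewrite -quotmod_piD !quotmod_scaleE scalerDr quotmod_piD.
Qed.

Lemma quotmod_scaleDl q : {morph quotmod_scale^~ q : a b / a + b}.
Proof.
move=> a b; have [x ->] := quotmod_ex q.
by rewrite !quotmod_scaleE scalerDl quotmod_piD.
Qed.

HB.instance Definition _ := GRing.Zmodule_isLmodule.Build K quotmod
  quotmod_scaleA quotmod_scale1 quotmod_scaleDr quotmod_scaleDl.

Lemma quotmod_pi_linear : linear quotmod_pi.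
Proof. by move=> a x y; rewrite quotmod_piD -quotmod_scaleE. Qed.

HB.instance Definition _ := GRing.isLinear.Build K L quotmod _ quotmod_pi
  quotmod_pi_linear.

End QuotientModule.

Section LieTheory.
Variable K : fieldType.

Section OneSpace.
Variables (g : lmodType K).
Variables (br : {bilinear g -> g -> g}) (delta : {linear g -> tensor g g}).

Definition is_lie_bracket : Prop :=
  (forall x, br x x = 0) /\
  (forall x y z, br x (br y z) + br y (br z x) + br z (br x y) = 0).

(* The adjoint action of x on the tensor square, hence on Lambda2. *)
Definition ad2 (x : g) (t : tensor g g) : tensor g g :=
  tens_map (br x) idfun t + tens_map idfun (br x) t.

Definition center : set g := [set x | forall y, br x y = 0].
Definition derived : set g := lspan [set br x y | x in setT & y in setT].
Definition Lambda2_invariants : set (tensor g g) :=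
  [set t | Lambda2 g t /\ forall x, ad2 x t = 0].

Definition coJacobi : Prop :=
  forall x, Alt (tens_map delta idfun (delta x)) = 0.

Definition is_lie_coalgebra : Prop :=
  (forall x, Lambda2 g (delta x)) /\ coJacobi.

Definition cocycle : Prop :=
  forall x y, delta (br x y) = ad2 x (delta y) - ad2 y (delta x).

Definition is_lie_bialgebra : Prop :=
  [/\ is_lie_bracket, is_lie_coalgebra & cocycle].

Definition lie_ideal (I : set g) : Prop := forall x y, I y -> I (br x y).
Definition coideal (I : set g) : Prop :=
  forall x, I x -> wedge_sub I setT (delta x).

Definition derivation (D : {linear g -> g}) : Prop :=
  forall x y, D (br x y) = br (D x) y + br x (D y).
Definition coderivation (D : {linear g -> g}) : Prop :=
  forall x, tens_map D idfun (delta x) + tens_map idfun D (delta x)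
            = delta (D x).

Definition BiDer : set (g -> g) :=
  [set (D : g -> g) | D in
     [set D : {linear g -> g} | derivation D /\ coderivation D]].

End OneSpace.

Definition commutator (g : zmodType) (E F : g -> g) : g -> g :=
  fun x => E (F x) - F (E x).

Definition lie_subalgebra_of (g : lmodType K) (B S : set (g -> g)) : Prop :=
  [/\ S `<=` B, lspan S `<=` S &
      forall E F, S E -> S F -> S (commutator E F)].

Section Morphisms.
Variables g h : lmodType K.
Variables (brg : {bilinear g -> g -> g}) (dg : {linear g -> tensor g g}).
Variables (brh : {bilinear h -> h -> h}) (dh : {linear h -> tensor h h}).

Definition lie_hom (f : {linear g -> h}) : Prop :=
  forall x y, f (brg x y) = brh (f x) (f y).
Definition colie_hom (f : {linear g -> h}) : Prop :=
  forall x, dh (f x) = tens_map f f (dg x).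
Definition bialg_hom (f : {linear g -> h}) : Prop := lie_hom f /\ colie_hom f.
Definition bialg_iso (f : {linear g -> h}) : Prop := bijective f /\ bialg_hom f.

End Morphisms.

(* The cobracket transported along a linear isomorphism f with inverse f'. *)
Definition transport (g h : lmodType K) (f : {linear g -> h})
    (f' : {linear h -> g}) (delta : {linear g -> tensor g g}) :
    h -> tensor h h :=
  tens_map f f \o delta \o f'.
HB.instance Definition _ g h f f' delta :=
  GRing.Linear.on (@transport g h f f' delta).

Section Dual.
Variables (V : vectType K) (dV : {linear V -> tensor V V}).

(* The transpose of dV; dual_bracket_basis below is its coordinate form.      *)
Definition dual_bracket (f h : 'Hom(V, K^o)) : 'Hom(V, K^o) :=
  linfun (fun v => tens_contract f h (dV v)).

Definition dual_basis (d : nat) (t : d.-tuple V) (i : 'I_d) : 'Hom(V, K^o) :=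
  linfun (coord t i : V -> K^o).

Lemma dual_bracketE (f h : 'Hom(V, K^o)) v :
  dual_bracket f h v = tens_contract f h (dV v).
Proof.
have e : linear (fun v => tens_contract f h (dV v)).
  by move=> a x y; rewrite !linearP.
pose F : {linear V -> K^o} := HB.pack (fun v => tens_contract f h (dV v))
  (GRing.isLinear.Build K V K^o _ _ e).
exact: (lfunE F v).
Qed.

Lemma dual_basisE d (t : d.-tuple V) i v : dual_basis t i v = coord t i v.
Proof.
have e : linear (coord t i : V -> K^o) by move=> a x y; rewrite linearP.
pose F : {linear V -> K^o} := HB.pack (coord t i : V -> K^o)
  (GRing.isLinear.Build K V K^o _ _ e).
exact: (lfunE F v).
Qed.

Lemma dual_bracket_basis d (t : d.-tuple V) (c : 'I_d -> 'I_d -> 'I_d -> K) :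
    [pchar K] =i pred0 -> basis_of fullv t ->
    (forall k i j, c k i j = - c k j i) ->
    (forall k, dV (tnth t k) =
       \sum_i \sum_j c k i j *: wedge (tnth t i) (tnth t j)) ->
  forall i j, dual_bracket (dual_basis t i) (dual_basis t j) =
    \sum_k c k i j *: dual_basis t k.
Proof.
move=> ch bt ca hd i j.
have fr := basis_free bt.
have ct a b : coord t a (tnth t b) = (b == a)%:R.
  by rewrite (tnth_nth 0) coord_free.
have two : (2%:R : K) != 0 by move/pcharf0P: ch => ->.
apply/lfunP => v; rewrite (coord_basis bt (memvf v)) !linear_sum.
apply: eq_bigr => k _; rewrite !linearZ /=; congr (_ *: _).
rewrite -tnth_nth dual_bracketE hd linear_sum.
have -> : (\sum_k c k i j *: dual_basis t k) (tnth t k) = c k i j.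
  rewrite sum_lfunE (bigD1 k) //= big1 => [|a /negbTE ak].
    by rewrite scale_lfunE dual_basisE ct eqxx addr0 /GRing.scale /= mulr1.
  by rewrite scale_lfunE dual_basisE ct eq_sym ak scaler0.
have E (a b : 'I_d) : tens_contract (dual_basis t i) (dual_basis t j)
    (c k a b *: wedge (tnth t a) (tnth t b)) =
    2%:R^-1 * ((a == i)%:R * ((b == j)%:R * c k a b)) +
    2%:R^-1 * ((b == i)%:R * ((a == j)%:R * c k b a)) :> K.
  rewrite linearZ /= /wedge linearZ linearB /= !tens_contractE /=.
  by rewrite !dual_basisE !ct [c k b a]ca /GRing.scale /=; ring.
have D (i' : 'I_d) (F : 'I_d -> K) : \sum_a ((a == i')%:R * F a) = F i'.
  rewrite (bigD1 i') //= eqxx mul1r big1 ?addr0 // => a /negbTE ->.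
  by rewrite mul0r.
transitivity (\sum_a \sum_b
    (2%:R^-1 * ((a == i)%:R * ((b == j)%:R * c k a b)) +
     2%:R^-1 * ((b == i)%:R * ((a == j)%:R * c k b a)))).
  by apply: eq_bigr => a _; rewrite linear_sum; apply: eq_bigr => b _; exact: E.
under eq_bigr => a _ do rewrite big_split /= -!mulr_sumr !D.
by rewrite big_split /= -!mulr_sumr !D; field.
Qed.

End Dual.

Section Product.
Variables (g V : lmodType K).
Local Notation L := (g * V)%type.

Definition in_l (x : g) : L := (x, 0).
Definition in_r (v : V) : L := (0, v).

Lemma in_l_linear : linear in_l.
Proof. by move=> a x y; congr (_, _); rewrite /= scaler0 addr0. Qed.
Lemma in_r_linear : linear in_r.
Proof. by move=> a x y; congr (_, _); rewrite /= scaler0 addr0. Qed.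

HB.instance Definition _ := GRing.isLinear.Build K g L _ in_l in_l_linear.
HB.instance Definition _ := GRing.isLinear.Build K V L _ in_r in_r_linear.

Definition sub_l : set L := range in_l.
Definition sub_r : set L := range in_r.

Definition in_sub_r (u : L) : bool := u.1 == 0.

Lemma in_sub_r_closed : subsemimod_closed in_sub_r.
Proof.
split=> [|a u]; last first.
  by rewrite !unfold_in /in_sub_r /= => /eqP ->; rewrite scaler0.
split=> [|u v]; first exact: eqxx.
by rewrite !unfold_in /in_sub_r /= => /eqP -> /eqP ->; rewrite addr0.
Qed.

Definition sub_r_submod : submodClosed L :=
  HB.pack_for (submodClosed L) in_sub_r
    (GRing.isSubmodClosed.Build K L in_sub_r in_sub_r_closed).

Lemma sub_rP u : sub_r u <-> u \in sub_r_submod.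
Proof.
split=> [[v _ <-]|]; first exact: eqxx.
by case: u => x v /eqP /= ->; exists v.
Qed.

(* The bracket of the product of g with the abelian Lie algebra V. *)
Definition prod_bracket (br : {bilinear g -> g -> g}) (u v : L) : L :=
  (br u.1 v.1, 0).

Lemma prod_bracket_bilinear br : bilinear_for *:%R *:%R (prod_bracket br).
Proof.
split=> [v a u u'|u a v v']; congr (_, _);
  by rewrite /= ?linearPl ?linearPr ?scaler0 ?addr0.
Qed.

HB.instance Definition _ br := bilinear_isBilinear.Build K L L L _ _
  (prod_bracket br) (prod_bracket_bilinear br).

Lemma prod_bracket_lie br :
  is_lie_bracket br -> is_lie_bracket (prod_bracket br).
Proof.
case=> alt jac; split=> [u|u v w]; first by congr (_, _); exact: alt.
by apply: injective_projections; rewrite /= ?addr0 //; exact: jac.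
Qed.

Definition prod_map (f : {linear g -> g}) (h : {linear V -> V}) (u : L) : L :=
  (f u.1, h u.2).

Lemma prod_map_linear f h : linear (prod_map f h).
Proof. by move=> a u v; congr (_, _); rewrite /= linearP. Qed.

HB.instance Definition _ f h := GRing.isLinear.Build K L L _ (prod_map f h)
  (prod_map_linear f h).

Definition cobracket_l (delta : {linear L -> tensor L L}) : g -> tensor g g :=
  tens_map fst fst \o delta \o in_l.
HB.instance Definition _ delta := GRing.Linear.on (cobracket_l delta).

Definition cobracket_r (delta : {linear L -> tensor L L}) : V -> tensor V V :=
  tens_map snd snd \o delta \o in_r.
HB.instance Definition _ delta := GRing.Linear.on (cobracket_r delta).

End Product.

Section Star.
Variables (g : lmodType K) (br : {bilinear g -> g -> g}) (V : vectType K).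
Local Notation L := (g * V)%type.
Variables (d : nat) (t : d.-tuple V).

Definition star (dg : {linear g -> tensor g g}) (dV : {linear V -> tensor V V})
    (D : 'I_d -> {linear g -> g}) (u : L) : tensor L L :=
  tens_map (@in_l g V) (@in_l g V) (dg u.1) +
  2%:R *: (\sum_(i < d) wedge (in_l V (D i u.1)) (in_r g (tnth t i))) +
  tens_map (@in_r g V) (@in_r g V) (dV u.2).

Lemma star_linear dg dV D : linear (star dg dV D).
Proof.
have wedgeP a (x y z : L) : wedge (a *: x + y) z = a *: wedge x z + wedge y z.
  rewrite /wedge linearPl linearPr scalerA mulrC -scalerA -scalerDr.
  by rewrite opprD addrACA -scalerBr.
have aux (W : lmodType K) (a c : K) (x x' y y' z z' : W) :
    (a *: x + x') + c *: (a *: y + y') + (a *: z + z')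
    = a *: (x + c *: y + z) + (x' + c *: y' + z').
  rewrite !scalerDr !scalerA (mulrC c) (addrACA (a *: x) x').
  by rewrite [LHS]addrACA.
move=> a u v; rewrite /star -aux; congr (_ + _ *: _ + _).
- by rewrite /= !linearP.
- rewrite scaler_sumr -big_split; apply: eq_bigr => i _.
  by rewrite /= !linearP wedgeP.
- by rewrite /= !linearP.
Qed.

HB.instance Definition _ dg dV D := GRing.isLinear.Build K L (tensor L L) _
  (star dg dV D) (star_linear dg dV D).

Definition lie_map_to_BiDer (dg : {linear g -> tensor g g})
    (dV : {linear V -> tensor V V})
    (DD : {linear 'Hom(V, K^o) -> (g -> g)}) : Prop :=
  (forall f, BiDer br dg (DD f)) /\
  (forall f h, DD (dual_bracket dV f h) = commutator (DD f) (DD h)).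

Definition star_data (dg : {linear g -> tensor g g})
    (dV : {linear V -> tensor V V}) (D : 'I_d -> {linear g -> g}) : Prop :=
  [/\ is_lie_bialgebra br dg, is_lie_coalgebra dV &
      exists2 DD : {linear 'Hom(V, K^o) -> (g -> g)},
        lie_map_to_BiDer dg dV DD &
        forall i, DD (dual_basis t i) = D i :> (g -> g)].

Definition transport_D (A : 'M[K]_d) (f f' : {linear g -> g})
    (D : 'I_d -> {linear g -> g}) (i : 'I_d) (x : g) : g :=
  \sum_(j < d) A i j *: f (D j (f' x)).

Lemma transport_D_linear A f f' D i : linear (transport_D A f f' D i).
Proof.
move=> a x y; rewrite /transport_D scaler_sumr -big_split.
apply: eq_bigr => j _; rewrite (linearP f') (linearP (D j)) (linearP f) /=.
by rewrite scalerDr !scalerA mulrC.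
Qed.

HB.instance Definition _ A f f' D i := GRing.isLinear.Build K g g _
  (transport_D A f f' D i) (transport_D_linear A f f' D i).

End Star.

End LieTheory.

(* Main.v *)
From HB Require Import structures.
Require Import Defs.
From mathcomp Require Import all_boot all_order all_algebra.
From mathcomp Require Import boolp classical_sets functions.

(** Why the theorem is true.  An antisymmetric tensor over [L = g * V] is
    determined by its part in [g (x) g], its part in [V (x) V] and, for every
    functional [f] on [V], the element of [g] obtained by applying [f] to the
    second factor of its part in [g (x) V].  Read through these components, a
    cobracket [delta] on [L] falls apart into a cobracket of [g], one of [V]
    and the maps [D_i] of [g] given by the functionals of a dual basis, and each
    axiom falls apart as well.

    The part of the cocycle identity in [g (x) g] is the cocycle identity on
    [g], the part in [g (x) V] says that the [D_i] are derivations.  The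
    cojacobiator, that is the left-hand side of co-Jacobi, is invariant under
    cyclic rotations, so only four of its eight parts matter: the ones in
    [g (x) g (x) g] and [V (x) V (x) V] are the cojacobiators of [g] and [V];
    the one in [g (x) g (x) V] measures the failure of the [D_i] to be
    coderivations ([cojacobiator_ggV]); the one in [g (x) V (x) V] measures the
    failure of the map from the dual of [V] to be a Lie algebra map
    ([cojacobiator_gVV]).  Hence a map of the form (star) is a Lie bialgebra
    structure exactly when its data satisfy the conditions of the theorem
    ([star_bialgebra], [star_bialgebra_data]).

    It remains to see that every cobracket has the form (star).  Since [V] is
    central, the cocycle identity makes [delta v] invariant under the adjoint
    action for [v] in [V].  Its part in [g (x) g] is then an invariant of the
    exterior square of [g], and its contractions to [g] are central, so both
    vanish ([delta_in_V]).  On [g], the part of [delta] with values in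
    [V (x) V] kills brackets, hence vanishes if [g] is perfect; if [dim V = 1]
    there is no nonzero antisymmetric tensor over [V] ([delta_in_g_VV]).

    The quotient [L / V] is identified with [g] by the first projection.  An
    automorphism [phi_g * phi_V] carries a (star) structure to the one with the
    transported data by direct computation ([star_transport]), and the axioms
    travel along surjective homomorphisms ([bialgebra_image]).  Conversely, if
    [g] is perfect and centerless, [V] is the center of [L] and [g] its derived
    algebra, so that every Lie automorphism preserves both
    ([lie_auto_diag]). *)

Set Implicit Arguments.
Unset Strict Implicit.
Unset Printing Implicit Defensive.

Import GRing.Theory.
Local Open Scope classical_set_scope.
Local Open Scope ring_scope.

(** * Maps on tensor products *)

Section TensorMaps.
Variable K : fieldType.

Lemma tens_ext (U V W : lmodType K) (f h : {linear tensor U V -> W}) :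
  (forall x y, f (tens x y) = h (tens x y)) -> f =1 h.
Proof.
move=> e t; have [s ->] := tens_gen t.
by rewrite !linear_sum; apply: eq_bigr => p _; exact: e.
Qed.

Lemma tens_ext3 (U V W X : lmodType K)
    (f h : {linear tensor (tensor U V) W -> X}) :
  (forall x y z, f (tens (tens x y) z) = h (tens (tens x y) z)) -> f =1 h.
Proof.
move=> e; apply: tens_ext => t z; have [s ->] := tens_gen t.
by rewrite linear_sumlz !linear_sum; apply: eq_bigr => p _; exact: e.
Qed.

Lemma tens_map_comp (U1 U2 U3 V1 V2 V3 : lmodType K)
    (f : {linear U1 -> U2}) (f' : {linear U2 -> U3})
    (h : {linear V1 -> V2}) (h' : {linear V2 -> V3}) t :
  tens_map f' h' (tens_map f h t) = tens_map (f' \o f) (h' \o h) t.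
Proof.
apply: (tens_ext (f := tens_map f' h' \o tens_map f h)) => x y /=.
by rewrite !tens_mapE.
Qed.

Lemma eq_tens_map (U V U' V' : lmodType K) (f f' : {linear U -> U'})
    (h h' : {linear V -> V'}) t :
  f =1 f' -> h =1 h' -> tens_map f h t = tens_map f' h' t.
Proof.
move=> ef eh; apply: tens_ext => x y /=.
by rewrite !tens_mapE ef eh.
Qed.

Lemma tens_map_id (U V : lmodType K) (f : {linear U -> U})
    (h : {linear V -> V}) t : f =1 id -> h =1 id -> tens_map f h t = t.
Proof.
move=> ef eh; apply: (tens_ext (h := idfun)) => x y /=.
by rewrite tens_mapE ef eh.
Qed.

Lemma tens_map3_comp (U1 U2 U3 V1 V2 V3 W1 W2 W3 : lmodType K)
    (f : {linear U1 -> U2}) (f' : {linear U2 -> U3})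
    (h : {linear V1 -> V2}) (h' : {linear V2 -> V3})
    (k : {linear W1 -> W2}) (k' : {linear W2 -> W3}) t :
  tens_map (tens_map f' h') k' (tens_map (tens_map f h) k t) =
  tens_map (tens_map (f' \o f) (h' \o h)) (k' \o k) t.
Proof.
by rewrite tens_map_comp; apply: eq_tens_map => // s; exact: tens_map_comp.
Qed.

Lemma tens_mapDl (U U' V V' : lmodType K) (f f' : {linear U -> U'})
    (h : {linear V -> V'}) t :
  tens_map (f \+ f') h t = tens_map f h t + tens_map f' h t.
Proof.
apply: (tens_ext (h := tens_map f h \+ tens_map f' h)) => x y /=.
by rewrite !tens_mapE linearDl.
Qed.

Lemma tens_mapDr (U U' V V' : lmodType K) (f : {linear U -> U'})
    (h h' : {linear V -> V'}) t :
  tens_map f (h \+ h') t = tens_map f h t + tens_map f h' t.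
Proof.
apply: (tens_ext (h := tens_map f h \+ tens_map f h')) => x y /=.
by rewrite !tens_mapE linearD.
Qed.

Lemma tens_map0l (U U' V V' : lmodType K) (f : {linear U -> U'})
    (h : {linear V -> V'}) t : (forall x, f x = 0) -> tens_map f h t = 0.
Proof.
move=> f0; apply: (tens_ext (h := \0)) => x y /=.
by rewrite tens_mapE f0 linear0l.
Qed.

Lemma tens_map0r (U U' V V' : lmodType K) (f : {linear U -> U'})
    (h : {linear V -> V'}) t : (forall x, h x = 0) -> tens_map f h t = 0.
Proof.
move=> h0; apply: (tens_ext (h := \0)) => x y /=.
by rewrite tens_mapE h0 linear0.
Qed.

Lemma tens_swap_map (U V U' V' : lmodType K) (f : {linear U -> U'})
    (h : {linear V -> V'}) t :
  tens_swap (tens_map f h t) = tens_map h f (tens_swap t).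
Proof.
apply: (tens_ext (f := @tens_swap _ _ _ \o tens_map f h)
                 (h := tens_map h f \o @tens_swap _ _ _)) => x y /=.
by rewrite tens_swapE !tens_mapE tens_swapE.
Qed.

End TensorMaps.

Section Contraction.
Variable K : fieldType.

Definition scale_by (U V : lmodType K) (f : {linear V -> K^o}) (x : U) (y : V) :
  U := (f y : K) *: x.

Lemma scale_by_bilinear (U V : lmodType K) (f : {linear V -> K^o}) :
  bilinear_for *:%R *:%R (@scale_by U V f).
Proof.
split=> [y a x x'|x a y y']; rewrite /scale_by /=.
  by rewrite scalerDr !scalerA mulrC.
by rewrite linearP scalerDl -scalerA.
Qed.

HB.instance Definition _ (U V : lmodType K) (f : {linear V -> K^o}) :=
  bilinear_isBilinear.Build K U V U _ _ (@scale_by U V f)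
  (@scale_by_bilinear U V f).

Definition contract_r (U V : lmodType K) (f : {linear V -> K^o}) :
  tensor U V -> U := tens_lift (@scale_by U V f).
HB.instance Definition _ (U V : lmodType K) (f : {linear V -> K^o}) :=
  GRing.Linear.on (@contract_r U V f).

Lemma contract_rE (U V : lmodType K) (f : {linear V -> K^o}) (x : U) y :
  contract_r f (tens x y) = (f y : K) *: x.
Proof. exact: tens_lift_tens. Qed.

Lemma contract_r_map (U U' V V' : lmodType K) (p : {linear U -> U'})
    (q : {linear V -> V'}) (f : {linear V' -> K^o}) t :
  contract_r f (tens_map p q t) = p (contract_r (f \o q) t).
Proof.
apply: (tens_ext (f := contract_r f \o tens_map p q)
                 (h := p \o contract_r (f \o q))) => x y /=.
by rewrite tens_mapE !contract_rE linearZ.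
Qed.

Lemma eq_contract_r (U V : lmodType K) (f f' : {linear V -> K^o})
    (t : tensor U V) : f =1 f' -> contract_r f t = contract_r f' t.
Proof.
by move=> e; apply: tens_ext => x y /=; rewrite !contract_rE e.
Qed.

End Contraction.

Section LinearityRules.
Variables (K : fieldType) (U U' V V' : lmodType K).
Variables (f : {linear U -> U'}) (h : {linear V -> V'}) (k : {linear V -> K^o}).

Lemma tens_map_add : {morph tens_map f h : s t / s + t}.
Proof. exact: linearD. Qed.
Lemma tens_map_sub : {morph tens_map f h : s t / s - t}.
Proof. exact: linearB. Qed.
Lemma tens_map_opp : {morph tens_map f h : s / - s}.
Proof. exact: linearN. Qed.
Lemma tens_map_scale a : {morph tens_map f h : s / a *: s}.
Proof. exact: linearZ_LR. Qed.
Lemma tens_map_zero : tens_map f h 0 = 0.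
Proof. exact: linear0. Qed.
Lemma tens_map_sum I (r : seq I) (P : pred I) F :
  tens_map f h (\sum_(i <- r | P i) F i) =
  \sum_(i <- r | P i) tens_map f h (F i).
Proof. exact: (linear_sum (tens_map f h)). Qed.

Lemma contract_r_add : {morph @contract_r K U V k : s t / s + t}.
Proof. exact: linearD. Qed.
Lemma contract_r_sub : {morph @contract_r K U V k : s t / s - t}.
Proof. exact: linearB. Qed.
Lemma contract_r_scale a : {morph @contract_r K U V k : s / a *: s}.
Proof. exact: linearZ_LR. Qed.
Lemma contract_r_zero : @contract_r K U V k 0 = 0.
Proof. exact: linear0. Qed.
Lemma contract_r_sum I (r : seq I) (P : pred I) F :
  @contract_r K U V k (\sum_(i <- r | P i) F i) =
  \sum_(i <- r | P i) contract_r k (F i).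
Proof. exact: (linear_sum (contract_r k)). Qed.

Lemma tens_swap_add : {morph @tens_swap K U V : s t / s + t}.
Proof. exact: linearD. Qed.
Lemma tens_swap_sub : {morph @tens_swap K U V : s t / s - t}.
Proof. exact: linearB. Qed.
Lemma tens_swap_scale a : {morph @tens_swap K U V : s / a *: s}.
Proof. exact: linearZ_LR. Qed.
Lemma tens_swap_sum I (r : seq I) (P : pred I) F :
  @tens_swap K U V (\sum_(i <- r | P i) F i) =
  \sum_(i <- r | P i) tens_swap (F i).
Proof. exact: (linear_sum (@tens_swap K U V)). Qed.

End LinearityRules.

(** * Cyclic rotation and the alternating sum *)

Section Alternation.
Variable K : fieldType.

Lemma cyc_map (U U' : lmodType K) (p q r : {linear U -> U'}) t :
  tens_map (tens_map p q) r (cyc t) = cyc (tens_map (tens_map q r) p t).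
Proof.
apply: (tens_ext3 (f := tens_map (tens_map p q) r \o @cyc _ _)
   (h := @cyc _ _ \o tens_map (tens_map q r) p)) => x y z /=.
by do 3 rewrite ?(tens_mapE, cycE) /=.
Qed.

Lemma cycK3 (U : lmodType K) (t : tensor (tensor U U) U) :
  cyc (cyc (cyc t)) = t.
Proof.
apply: (tens_ext3 (f := @cyc _ _ \o (@cyc _ _ \o @cyc _ _)) (h := idfun)).
by move=> x y z /=; rewrite !cycE.
Qed.

Lemma Alt_map (U U' : lmodType K) (f : {linear U -> U'}) t :
  Alt (tens_map (tens_map f f) f t) = tens_map (tens_map f f) f (Alt t).
Proof.
have sw : tens_map (@tens_swap _ _ _) idfun (tens_map (tens_map f f) f t) =
    tens_map (tens_map f f) f (tens_map (@tens_swap _ _ _) idfun t).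
  rewrite !tens_map_comp; apply: eq_tens_map => // s /=.
  exact: tens_swap_map.
by rewrite /Alt sw -!cyc_map tens_map_sub !tens_map_add.
Qed.

Lemma cyc_Alt (U : lmodType K) (t : tensor (tensor U U) U) :
  cyc (Alt t) = Alt t.
Proof.
rewrite /Alt (linearB (@cyc _ _)) !(linearD (@cyc _ _)) /= !cycK3.
by congr (_ - _); rewrite addrC addrA.
Qed.

Lemma Alt_antisym (U : lmodType K) (t : tensor (tensor U U) U) :
  tens_map (@tens_swap _ _ _) idfun t = - t ->
  Alt t = 2%:R *: (t + cyc t + cyc (cyc t)).
Proof.
move=> e; rewrite /Alt e !(linearN (@cyc _ _)) -!opprD opprK.
by rewrite scaler_nat mulr2n.
Qed.

End Alternation.

(** * Spans, wedges and antisymmetric tensors *)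

Section Spans.
Variable K : fieldType.

Lemma lspan0 (U : lmodType K) (A : set U) : lspan A 0.
Proof.
by exists 0%N, (fun=> 0), (fun=> 0); rewrite big_ord0; split=> // -[].
Qed.

Lemma lspanD (U : lmodType K) (A : set U) x y :
  lspan A x -> lspan A y -> lspan A (x + y).
Proof.
move=> [n [c [u [uA ->]]]] [m [c' [u' [u'A ->]]]].
pose glue T (v : 'I_n -> T) (v' : 'I_m -> T) (i : 'I_(n + m)) :=
  match fintype.split i with inl j => v j | inr j => v' j end.
exists (n + m)%N, (glue _ c c'), (glue _ u u').
split=> [i|]; first by rewrite /glue; case: fintype.split => j.
rewrite big_split_ord; congr (_ + _); apply: eq_bigr => i _; rewrite /glue /=.
  by rewrite (unsplitK (inl i)).
by rewrite (unsplitK (inr i)).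
Qed.

Lemma lspanZ (U : lmodType K) (A : set U) a x : lspan A x -> lspan A (a *: x).
Proof.
move=> [n [c [u [uA ->]]]]; exists n, (fun i => a * c i), u; split=> //.
by rewrite scaler_sumr; apply: eq_bigr => i _; rewrite scalerA.
Qed.

Lemma lspan_sum (U : lmodType K) (A : set U) I (r : seq I) (P : pred I)
    (F : I -> U) :
  (forall i, P i -> lspan A (F i)) -> lspan A (\sum_(i <- r | P i) F i).
Proof. by move=> h; apply: big_ind => //; [exact: lspan0|exact: lspanD]. Qed.

Lemma lspan_gen (U : lmodType K) (A : set U) x : A x -> lspan A x.
Proof.
by move=> Ax; exists 1%N, (fun=> 1), (fun=> x); rewrite big_ord1 scale1r.
Qed.

Lemma lspan_min (U W : lmodType K) (f : {linear U -> W}) (A : set U)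
    (B : set W) :
  (forall x, A x -> lspan B (f x)) -> forall x, lspan A x -> lspan B (f x).
Proof.
move=> h _ [n [c [u [uA ->]]]]; rewrite linear_sum; apply: lspan_sum => i _.
by rewrite linearZ /=; exact/lspanZ/h.
Qed.

Lemma eq0_lspan (U W : lmodType K) (f : {linear U -> W}) (A : set U) :
  (forall x, A x -> f x = 0) -> forall x, lspan A x -> f x = 0.
Proof.
move=> h _ [n [c [u [uA ->]]]]; rewrite linear_sum big1 // => i _.
by rewrite linearZ /= (h _ (uA i)) scaler0.
Qed.

Lemma wedge_map (U W : lmodType K) (f : {linear U -> W}) x y :
  tens_map f f (wedge x y) = wedge (f x) (f y).
Proof. by rewrite /wedge linearZ /= linearB /= !tens_mapE. Qed.

Lemma swap_wedge (U : lmodType K) (x y : U) :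
  tens_swap (wedge x y) = - wedge x y.
Proof. by rewrite /wedge linearZ linearB /= !tens_swapE -scalerN opprB. Qed.

Lemma wedge0r (U : lmodType K) (x : U) : wedge x 0 = 0.
Proof. by rewrite /wedge linear0 linear0l subrr scaler0. Qed.

Lemma wedge0l (U : lmodType K) (x : U) : wedge 0 x = 0.
Proof. by rewrite /wedge linear0 linear0l subrr scaler0. Qed.

Lemma wedge_suml (U : lmodType K) I (r : seq I) (P : pred I) (F : I -> U) y :
  wedge (\sum_(i <- r | P i) F i) y = \sum_(i <- r | P i) wedge (F i) y.
Proof.
by rewrite /wedge linear_sumlz linear_sum -sumrB scaler_sumr.
Qed.

Lemma wedge_sumr (U : lmodType K) I (r : seq I) (P : pred I) (F : I -> U) x :
  wedge x (\sum_(i <- r | P i) F i) = \sum_(i <- r | P i) wedge x (F i).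
Proof.
by rewrite /wedge linear_sumlz linear_sum -sumrB scaler_sumr.
Qed.

Lemma wedgeZl (U : lmodType K) a (x y : U) : wedge (a *: x) y = a *: wedge x y.
Proof.
by rewrite /wedge linearZ /= linearZl_LR -scalerBr !scalerA mulrC.
Qed.

Lemma wedgeZr (U : lmodType K) a (x y : U) : wedge x (a *: y) = a *: wedge x y.
Proof.
by rewrite /wedge linearZ /= linearZl_LR -scalerBr !scalerA mulrC.
Qed.

Lemma wedge_sub_map (U W : lmodType K) (f : {linear U -> W}) (A B : set U)
    (A' B' : set W) :
  (forall x, A x -> A' (f x)) -> (forall x, B x -> B' (f x)) ->
  forall t, wedge_sub A B t -> wedge_sub A' B' (tens_map f f t).
Proof.
move=> fA fB; apply: lspan_min => _ [a Aa [b Bb <-]].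
rewrite /= wedge_map; apply: lspan_gen.
by exists (f a); [exact: fA|exists (f b); [exact: fB|]].
Qed.

Section CharacteristicZero.
Hypothesis charK : [pchar K] =i pred0.

Lemma two_neq0 : (2%:R : K) != 0.
Proof. by move/pcharf0P: charK => ->. Qed.

Lemma scale2_eq0 (W : lmodType K) (w : W) : 2%:R *: w = 0 -> w = 0.
Proof. by move/eqP; rewrite scaler_eq0 (negbTE two_neq0) => /eqP. Qed.

Lemma double_wedge (U : lmodType K) (x y : U) :
  2%:R *: wedge x y = tens x y - tens y x.
Proof. by rewrite /wedge scalerA divff ?scale1r // two_neq0. Qed.

(** An antisymmetric tensor is half the difference of itself and its swap; on a
    pure tensor such a half-difference is a wedge, hence the direction from
    right to left. *)
Lemma Lambda2P (U : lmodType K) (t : tensor U U) :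
  Lambda2 U t <-> tens_swap t = - t.
Proof.
split=> [|e].
  move=> h; apply/eqP; rewrite -subr_eq0 opprK; apply/eqP.
  apply: (eq0_lspan (f := @tens_swap _ _ _ \+ idfun)) h => _ [a _ [b _ <-]] /=.
  by rewrite swap_wedge addNr.
have -> : t = 2%:R^-1 *: (t - tens_swap t).
  by rewrite e opprK -mulr2n -scaler_nat scalerA mulVf ?two_neq0 ?scale1r.
have [s ->] := tens_gen t.
rewrite (linear_sum (@tens_swap _ _ _)) -sumrB scaler_sumr.
apply: lspan_sum => p _; apply: lspan_gen; exists p.1 => //; exists p.2 => //=.
by rewrite tens_swapE.
Qed.

End CharacteristicZero.
End Spans.

(** * The adjoint action *)

Section Adjoint.
Variable K : fieldType.

Lemma lie_bracket_anti (h : lmodType K) (b : {bilinear h -> h -> h}) x y :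
  is_lie_bracket b -> b x y = - b y x.
Proof.
case=> alt _; apply/eqP; rewrite -addr_eq0; apply/eqP.
by have := alt (x + y); rewrite linearDl !linearD /= !alt add0r addr0.
Qed.

Lemma swap_ad2 (U : lmodType K) (b : {bilinear U -> U -> U}) (u : U) s :
  tens_swap (ad2 b u s) = ad2 b u (tens_swap s).
Proof.
by rewrite /ad2 tens_swap_add !tens_swap_map addrC.
Qed.

Lemma ad2_opp (U : lmodType K) (b : {bilinear U -> U -> U}) (u : U) s :
  ad2 b u (- s) = - ad2 b u s.
Proof. by rewrite /ad2 !tens_map_opp -opprD. Qed.

Lemma ad2_map (U W : lmodType K) (f : {linear U -> W})
    (brU : {bilinear U -> U -> U}) (brW : {bilinear W -> W -> W}) x t :
  lie_hom brU brW f ->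
  tens_map f f (ad2 brU x t) = ad2 brW (f x) (tens_map f f t).
Proof.
move=> fh; rewrite /ad2 tens_map_add !tens_map_comp.
by congr (_ + _); apply: eq_tens_map => // y /=; rewrite fh.
Qed.

End Adjoint.

(** * The cojacobiator and its mixed components *)

Section Cojacobiator.
Variable K : fieldType.

Definition cojacobiator (U : lmodType K) (delta : {linear U -> tensor U U}) x :=
  Alt (tens_map delta idfun (delta x)).

Lemma cojacobiator_hom (U W : lmodType K) (dU : {linear U -> tensor U U})
    (dW : {linear W -> tensor W W}) (f : {linear U -> W}) x :
  colie_hom dU dW f ->
  cojacobiator dW (f x) = tens_map (tens_map f f) f (cojacobiator dU x).
Proof.
move=> fh; rewrite /cojacobiator fh -Alt_map !tens_map_comp; congr Alt.
by apply: eq_tens_map => // y /=; rewrite fh.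
Qed.

Section Components.
Variables (U g V : lmodType K) (p : {linear U -> g}) (q : {linear U -> V}).
Variable delta : {linear U -> tensor U U}.
Hypothesis delta_anti : forall u, tens_swap (delta u) = - delta u.

(** If [U] is the product of [g] and [V], this reads: the coefficient along
    [f] of the part of [delta] in [g (x) V] is [D] on [g] and zero on [V]. *)
Definition contracts_to (f : {linear V -> K^o}) (D : g -> g) :=
  forall u, contract_r f (tens_map p q (delta u)) = D (p u).

(** Antisymmetry of [delta] makes the two halves of [Alt] equal. *)
Lemma cojacobiatorE u (T := tens_map delta idfun (delta u)) :
  cojacobiator delta u = 2%:R *: (T + cyc T + cyc (cyc T)).
Proof.
apply: Alt_antisym; rewrite /T tens_map_comp.
apply: (tens_ext (f := tens_map (@tens_swap _ _ _ \o delta) (idfun \o idfun))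
                 (h := -%R \o tens_map delta idfun)) => x y /=.
by rewrite !tens_mapE /= delta_anti linearNl.
Qed.

Lemma contracts_to_swap (f : {linear V -> K^o}) (D : g -> g) u :
  contracts_to f D ->
  contract_r f (tens_map p q (tens_swap (delta u))) = - D (p u).
Proof.
move=> hf; rewrite delta_anti (linearN (tens_map p q)).
by rewrite (linearN (contract_r f)) /= hf.
Qed.

(** Write [T] for [(delta (x) id) (delta u)].  The last factor of [T] comes from
    the [delta] applied first; contracting it with [f] turns this [delta] into
    [D] and gives [dg o D].  In the two rotations of [T] the contracted factor
    comes from the [delta] applied second: this gives [D] on the first factor of
    [dg], up to a swap or a sign, and the antisymmetry of [dg] turns both into
    the two terms of a coderivation. *)
Lemma cojacobiator_ggV (dg : {linear g -> tensor g g}) (f : {linear V -> K^o})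
    (D : {linear g -> g}) u :
  colie_hom delta dg p -> contracts_to f D ->
  contract_r f (tens_map (tens_map p p) q (cojacobiator delta u)) =
  2%:R *: (dg (D (p u)) -
           (tens_map D idfun (dg (p u)) + tens_map idfun D (dg (p u)))).
Proof.
move=> hp hf; rewrite cojacobiatorE; set T := tens_map delta _ _.
pose c : {linear _ -> _} := contract_r f \o tens_map (tens_map p p) q.
pose m : {linear _ -> _} := contract_r f \o tens_map p q.
have cT : c T = dg (D (p u)).
  rewrite /c /= tens_map_comp -hf -(contract_r_map dg idfun) tens_map_comp.
  by congr contract_r; apply: eq_tens_map => // x /=; rewrite hp.
have cT1 : c (cyc T) = tens_swap (tens_map D idfun (dg (p u))).
  transitivity (tens_swap (tens_map m p T)).
    apply: (tens_ext3 (f := c \o @cyc _ _)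
      (h := @tens_swap _ _ _ \o tens_map m p)) => x y z /=.
    rewrite cycE !tens_mapE tens_swapE /m /= !tens_mapE !contract_rE.
    by rewrite linearZ.
  rewrite hp !tens_map_comp; congr tens_swap.
  by apply: eq_tens_map => // x; exact: hf.
have cT2 : c (cyc (cyc T)) = - tens_map D idfun (dg (p u)).
  transitivity (tens_map (m \o @tens_swap _ _ _) p T).
    apply: (tens_ext3 (f := c \o (@cyc _ _ \o @cyc _ _))
      (h := tens_map (m \o @tens_swap _ _ _) p)) => x y z /=.
    rewrite !cycE !tens_mapE /m /= tens_swapE !tens_mapE !contract_rE.
    by rewrite linearZl.
  rewrite hp !tens_map_comp.
  apply: (tens_ext (h := -%R \o tens_map (D \o p) (idfun \o p))) => x y /=.
  by rewrite !tens_mapE /= (contracts_to_swap _ hf) linearNl.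
have sw : tens_swap (dg (p u)) = - dg (p u).
  by rewrite hp tens_swap_map delta_anti linearN.
rewrite -[LHS]/(c _) (linearZ_LR c) !(linearD c) cT cT1 cT2.
by rewrite tens_swap_map sw linearN /= opprD addrA addrAC.
Qed.

(** Each of the three rotations of [T] contributes one term.  In [T] itself the
    functionals meet the second factors of the two copies of [delta]; in the
    second rotation they trade places and one of them meets a first factor,
    whence the sign; in the first rotation both meet the [delta] applied second,
    which can then only contribute [dV], so that [f] and [h] combine into the
    dual bracket [k], applied to a first factor of the other [delta]. *)
Lemma cojacobiator_gVV (dV : {linear V -> tensor V V})
    (f h k : {linear V -> K^o}) (Df Dh Dk : {linear g -> g}) u :
  colie_hom delta dV q -> contracts_to f Df -> contracts_to h Dh ->
  contracts_to k Dk -> (forall v, k v = tens_contract f h (dV v)) ->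
  contract_r f
    (contract_r h (tens_map (tens_map p q) q (cojacobiator delta u))) =
  2%:R *: (Df (Dh (p u)) - Dh (Df (p u)) - Dk (p u)).
Proof.
move=> hq hf hh hk kE; rewrite cojacobiatorE; set T := tens_map delta _ _.
pose c : {linear _ -> _} :=
  contract_r f \o (contract_r h \o tens_map (tens_map p q) q).
pose m : {linear _ -> _} := contract_r h \o tens_map p q.
have cT : c T = Df (Dh (p u)).
  rewrite /c /= tens_map_comp -hh -(contract_r_map Df idfun) tens_map_comp.
  rewrite -(contract_r_map (contract_r f) idfun) tens_map_comp.
  by congr contract_r; apply: eq_tens_map => // x; exact: hf.
have cT1 : c (cyc T) = - Dk (p u).
  transitivity (contract_r (tens_contract f h)
                  (tens_swap (tens_map (tens_map q q) p T))).
    apply: (tens_ext3 (f := c \o @cyc _ _)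
      (h := contract_r (tens_contract f h) \o
              (@tens_swap _ _ _ \o tens_map (tens_map q q) p))) => x y z /=.
    rewrite cycE !tens_mapE /= !tens_mapE tens_swapE !contract_rE linearZ /=.
    by rewrite contract_rE tens_contractE scalerA mulrC.
  rewrite tens_map_comp tens_swap_map -(contracts_to_swap u hk).
  rewrite contract_r_map contract_r_map /=.
  congr (p _); apply: eq_contract_r => v.
  by rewrite /= -hq -kE.
have cT2 : c (cyc (cyc T)) = - Dh (Df (p u)).
  transitivity (contract_r f (tens_map (m \o @tens_swap _ _ _) q T)).
    apply: (tens_ext3 (f := c \o (@cyc _ _ \o @cyc _ _))
      (h := contract_r f \o
              tens_map (m \o @tens_swap _ _ _) q)) => x y z /=.
    rewrite !cycE !tens_mapE /m /= tens_swapE !tens_mapE !contract_rE.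
    by rewrite linearZ /= contract_rE !scalerA mulrC.
  rewrite tens_map_comp -hf -(contract_r_map Dh idfun) tens_map_comp.
  apply: (tens_ext
    (f := contract_r f \o tens_map (m \o @tens_swap _ _ _ \o delta) q)
    (h := -%R \o (contract_r f \o tens_map (Dh \o p) q))) => x y /=.
  by rewrite !tens_mapE !contract_rE /= (contracts_to_swap _ hh) scalerN.
rewrite -[LHS]/(c _) (linearZ_LR c) !(linearD c) cT cT1 cT2.
by congr (_ *: _); rewrite addrAC.
Qed.

End Components.
End Cojacobiator.

(** * Images of coalgebras and bialgebras *)

Section Image.
Variable K : fieldType.
Hypothesis charK : [pchar K] =i pred0.
Variables (U W : lmodType K) (f : {linear U -> W}).
Hypothesis f_surj : forall w, exists u, w = f u.
Variables (dU : {linear U -> tensor U U}) (dW : {linear W -> tensor W W}).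
Hypothesis f_colie : colie_hom dU dW f.

Lemma coalgebra_image : is_lie_coalgebra dU -> is_lie_coalgebra dW.
Proof.
move=> [lU jU]; split=> w; have [u ->] := f_surj w.
  apply/Lambda2P => //; rewrite f_colie tens_swap_map.
  by have /Lambda2P -> := lU u; rewrite // linearN.
rewrite -[LHS]/(cojacobiator dW _) (cojacobiator_hom _ f_colie).
by rewrite /cojacobiator jU linear0.
Qed.

(** Every axiom is an identity between expressions that a homomorphism
    respects, so it only has to be checked on the image. *)
Lemma bialgebra_image (brU : {bilinear U -> U -> U})
    (brW : {bilinear W -> W -> W}) :
  lie_hom brU brW f -> is_lie_bialgebra brU dU -> is_lie_bialgebra brW dW.
Proof.
move=> fh [[altU jacU] cU cocU]; split; last 2 first.
- exact: coalgebra_image.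
- move=> w w'; have [u ->] := f_surj w; have [u' ->] := f_surj w'.
  by rewrite -fh !f_colie cocU linearB /= !(ad2_map _ _ fh).
split=> [w|w w' w''].
  by have [u ->] := f_surj w; rewrite -fh altU linear0.
have [u ->] := f_surj w; have [u' ->] := f_surj w'.
by have [u'' ->] := f_surj w''; rewrite -!fh -!linearD jacU linear0.
Qed.

End Image.

Lemma bialgebra_eq (K : fieldType) (U : lmodType K)
    (b : {bilinear U -> U -> U}) (delta delta' : {linear U -> tensor U U}) :
  [pchar K] =i pred0 -> delta =1 delta' ->
  is_lie_bialgebra b delta -> is_lie_bialgebra b delta'.
Proof.
move=> charK e; apply: (bialgebra_image charK (f := idfun)) => //.
  by move=> w; exists w.
by move=> u; rewrite /= tens_map_id // e.
Qed.

(** * Components of tensors over a product *)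

Section Basis.
Variables (K : fieldType) (V : vectType K) (d : nat) (t : d.-tuple V).
Hypothesis basis_t : basis_of fullv t.

Lemma dual_basis_sum v : v = \sum_i (dual_basis t i v : K) *: tnth t i.
Proof.
rewrite {1}(coord_basis basis_t (memvf v)); apply: eq_bigr => i _.
by rewrite dual_basisE (tnth_nth 0).
Qed.

Lemma dual_basis_tnth i j : dual_basis t i (tnth t j) = (j == i)%:R :> K.
Proof.
by rewrite dual_basisE (tnth_nth 0) coord_free // (basis_free basis_t).
Qed.

Lemma dual_basis_expand (f : 'Hom(V, K^o)) :
  f = \sum_i (f (tnth t i) : K) *: dual_basis t i.
Proof.
apply/lfunP => v; rewrite {1}(dual_basis_sum v) linear_sum sum_lfunE.
by apply: eq_bigr => i _; rewrite linearZ scale_lfunE; exact: mulrC.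
Qed.

Lemma contract_r_expand (U : lmodType K) (s : tensor U V) :
  s = \sum_i tens (contract_r (dual_basis t i) s) (tnth t i).
Proof.
have [r sE] := tens_gen s; rewrite {1}sE.
transitivity (\sum_(p <- r) \sum_i
    tens ((dual_basis t i p.2 : K) *: p.1) (tnth t i)).
  apply: eq_bigr => p _; rewrite {1}(dual_basis_sum p.2) linear_sum.
  by apply: eq_bigr => i _; rewrite linearZ /= linearZl_LR.
rewrite exchange_big; apply: eq_bigr => i _; rewrite -linear_sumlz.
congr tens; rewrite sE linear_sum; apply: eq_bigr => p _ /=.
by rewrite contract_rE.
Qed.

Lemma contract_r_eq0 (U : lmodType K) (s : tensor U V) :
  (forall i, contract_r (dual_basis t i) s = 0) -> s = 0.
Proof.
by move=> h; rewrite (contract_r_expand s) big1 // => i _; rewrite h linear0l.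
Qed.

Variable g : lmodType K.
Local Notation L := (g * V)%type.
Local Notation in_g := (@in_l K g V).
Local Notation in_V := (@in_r K g V).

Lemma tensor_prod_decomp (s : tensor L L) :
  s = tens_map in_g in_g (tens_map fst fst s) +
      tens_map in_g in_V (tens_map fst snd s) +
      tens_map in_V in_g (tens_map snd fst s) +
      tens_map in_V in_V (tens_map snd snd s).
Proof.
pose e0 : {linear L -> L} := in_g \o fst.
pose e1 : {linear L -> L} := in_V \o snd.
have id_sum (u : L) : (e0 \+ e1) u = u.
  by case: u => x v; congr (_, _); rewrite /= ?addr0 ?add0r.
rewrite -[LHS](@tens_map_id _ _ _ (e0 \+ e1) (e0 \+ e1)) // !tens_map_comp.
by rewrite tens_mapDl !tens_mapDr !addrA.
Qed.

(** The part in [V (x) g] is minus the swap of the part in [g (x) V]; together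
    they form the wedges. *)
Lemma antisym_prod_decomp (s : tensor L L) : [pchar K] =i pred0 ->
  tens_swap s = - s ->
  s = tens_map in_g in_g (tens_map fst fst s) +
      2%:R *: \sum_i wedge
        (in_g (contract_r (dual_basis t i) (tens_map fst snd s)))
        (in_V (tnth t i)) +
      tens_map in_V in_V (tens_map snd snd s).
Proof.
move=> charK sw; rewrite {1}(tensor_prod_decomp s); congr (_ + _).
rewrite -addrA; congr (_ + _).
rewrite scaler_sumr; under eq_bigr => i _ do rewrite double_wedge //.
rewrite sumrB; set m := tens_map fst snd s.
have -> : tens_map snd fst s = - tens_swap m.
  by rewrite /m tens_swap_map sw linearN opprK.
rewrite linearN /= -tens_swap_map.
have -> : tens_map in_g in_V m =
    \sum_i tens (in_g (contract_r (dual_basis t i) m)) (in_V (tnth t i)).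
  rewrite {1}(contract_r_expand m) linear_sum; apply: eq_bigr => i _.
  by rewrite /= tens_mapE.
rewrite (linear_sum (@tens_swap _ _ _)); congr (_ - _).
by apply: eq_bigr => i _; rewrite /= tens_swapE.
Qed.

Lemma antisym_prod_eq0 (s : tensor L L) : [pchar K] =i pred0 ->
  tens_swap s = - s -> tens_map fst fst s = 0 -> tens_map snd snd s = 0 ->
  (forall i, contract_r (dual_basis t i) (tens_map fst snd s) = 0) -> s = 0.
Proof.
move=> charK sw s00 s11 s01; rewrite (antisym_prod_decomp charK sw) s00 s11.
rewrite !linear0 add0r addr0 big1 ?scaler0 // => i _.
by rewrite s01 linear0 /wedge linear0l linear0 subr0 scaler0.
Qed.

(** Cyclic invariance moves the three components with one factor in [V] onto
    each other, and likewise the three with two factors in [V]; one contraction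
    hypothesis for each kind is enough. *)
Lemma cyclic_prod_eq0 (T : tensor (tensor L L) L) : cyc T = T ->
  tens_map (tens_map fst fst) fst T = 0 ->
  tens_map (tens_map snd snd) snd T = 0 ->
  (forall i, contract_r (dual_basis t i)
     (tens_map (tens_map fst fst) snd T) = 0) ->
  (forall i j, contract_r (dual_basis t i) (contract_r (dual_basis t j)
     (tens_map (tens_map fst snd) snd T)) = 0) ->
  T = 0.
Proof.
move=> cT T000 T111 c001 c011.
have T001 := contract_r_eq0 c001.
have T011 : tens_map (tens_map fst snd) snd T = 0.
  by apply: contract_r_eq0 => j; apply: contract_r_eq0 => i.
pose e0 : {linear L -> L} := in_g \o fst.
pose e1 : {linear L -> L} := in_V \o snd.
pose P p q r : {linear tensor (tensor L L) L -> _} :=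
  @tens_map K (tensor L L) (tensor L L) L L (@tens_map K L L L L p q) r.
have id_sum (u : L) : (e0 \+ e1) u = u.
  by case: u => x v; congr (_, _); rewrite /= ?addr0 ?add0r.
have rot p q r : P p q r T = 0 -> P r p q T = 0.
  by move=> h; rewrite -{1}cT /P /= cyc_map -/(P p q r T) h linear0.
have P000 : P e0 e0 e0 T = 0 by rewrite /P /= -tens_map3_comp T000 linear0.
have P111 : P e1 e1 e1 T = 0 by rewrite /P /= -tens_map3_comp T111 linear0.
have P001 : P e0 e0 e1 T = 0 by rewrite /P /= -tens_map3_comp T001 linear0.
have P011 : P e0 e1 e1 T = 0 by rewrite /P /= -tens_map3_comp T011 linear0.
have TE : T = P (e0 \+ e1) (e0 \+ e1) (e0 \+ e1) T.
  rewrite /P /= tens_map_id // => s; exact: tens_map_id.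
have split3 (p q r r' : {linear L -> L}) :
    P p q (r \+ r') T = P p q r T + P p q r' T.
  exact: tens_mapDr.
have split2 (p q q' r : {linear L -> L}) :
    P p (q \+ q') r T = P p q r T + P p q' r T.
  rewrite -[RHS]tens_mapDl; apply: eq_tens_map => // s; exact: tens_mapDr.
have split1 (p p' q r : {linear L -> L}) :
    P (p \+ p') q r T = P p q r T + P p' q r T.
  rewrite -[RHS]tens_mapDl; apply: eq_tens_map => // s; exact: tens_mapDl.
have P100 := rot _ _ _ P001; have P010 := rot _ _ _ P100.
have P101 := rot _ _ _ P011; have P110 := rot _ _ _ P101.
clearbody P e0 e1.
rewrite TE split1 !split2 !split3.
by rewrite P000 P001 P010 P011 P100 P101 P110 P111 !addr0.
Qed.

End Basis.

(** * Lie bialgebra structures of the form (star) *)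

Section ProductProjections.
Variables (K : fieldType) (g : lmodType K) (br : {bilinear g -> g -> g}).
Variable V : lmodType K.
Local Notation L := (g * V)%type.
Local Notation brL := (prod_bracket br).

Lemma lie_hom_fst :
  lie_hom (brL : {bilinear L -> L -> L}) br (fst : {linear L -> g}).
Proof. by []. Qed.

Lemma fst_surj (x : g) : exists u : L, x = fst u.
Proof. by exists (x, 0). Qed.

Lemma snd_surj (x : V) : exists u : L, x = snd u.
Proof. by exists (0, x). Qed.

Lemma contract_ad2 (f : {linear V -> K^o}) (u : L) s :
  contract_r f (tens_map fst snd (ad2 brL u s)) =
  br u.1 (contract_r f (tens_map fst snd s)).
Proof.
rewrite /ad2 tens_map_add !tens_map_comp.
rewrite [tens_map (fst \o idfun) _ _]tens_map0r // addr0.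
rewrite -(contract_r_map (br u.1) idfun) tens_map_comp.
by congr contract_r; apply: eq_tens_map.
Qed.

Lemma snd_ad2 (u : L) s : tens_map snd snd (ad2 brL u s) = 0.
Proof.
rewrite /ad2 tens_map_add !tens_map_comp.
by rewrite tens_map0l // tens_map0r // addr0.
Qed.

End ProductProjections.

Section StarStructure.
Variable K : fieldType.
Hypothesis charK : [pchar K] =i pred0.
Variables (g : lmodType K) (br : {bilinear g -> g -> g}).
Hypothesis lie_g : is_lie_bracket br.
Variables (V : vectType K) (d : nat) (t : d.-tuple V).
Hypothesis basis_t : basis_of fullv t.
Local Notation L := (g * V)%type.
Local Notation in_g := (@in_l K g V).
Local Notation in_V := (@in_r K g V).
Local Notation brL := (prod_bracket br).

Definition dual_interp (D : 'I_d -> {linear g -> g}) (f : 'Hom(V, K^o)) : g -> g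
  := fun x => \sum_i (f (tnth t i) : K) *: D i x.

(** [dual_interp D f] is linear in [f] and as a map of [g]; a constant carries
    only one linear structure, so the second needs a name of its own. *)
Definition dual_interp_at D f : g -> g := dual_interp D f.

Lemma dual_interp_linear D : linear (dual_interp D).
Proof.
move=> a f h; apply/funext => x; rewrite /dual_interp.
rewrite -[RHS]/(a *: (\sum_i (f (tnth t i) : K) *: D i x) +
                \sum_i (h (tnth t i) : K) *: D i x).
rewrite scaler_sumr -big_split; apply: eq_bigr => i _ /=.
by rewrite add_lfunE scale_lfunE scalerDl scalerA.
Qed.

HB.instance Definition _ D := GRing.isLinear.Build K _ (g -> g) _
  (dual_interp D) (dual_interp_linear D).

Lemma dual_interp_at_linear D f : linear (dual_interp_at D f).
Proof.
move=> a x y; rewrite /dual_interp_at /dual_interp scaler_sumr -big_split.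
by apply: eq_bigr => i _ /=; rewrite linearP scalerDr !scalerA mulrC.
Qed.

HB.instance Definition _ D f := GRing.isLinear.Build K g g _
  (dual_interp_at D f) (dual_interp_at_linear D f).

Lemma dual_interp_basis D i : dual_interp D (dual_basis t i) = D i.
Proof.
apply/funext => x; rewrite /dual_interp (bigD1 i) //= big1 => [|j /negbTE ji].
  by rewrite dual_basis_tnth // eqxx scale1r addr0.
by rewrite dual_basis_tnth // ji scale0r.
Qed.

Lemma dual_interp_unique (D : 'I_d -> {linear g -> g})
    (DD : {linear 'Hom(V, K^o) -> (g -> g)}) :
  (forall i, DD (dual_basis t i) = D i :> (g -> g)) -> DD =1 dual_interp D.
Proof.
move=> h f; rewrite {1}(dual_basis_expand basis_t f) linear_sum.
apply/funext => x; rewrite fct_sumE; apply: eq_bigr => i _.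
by rewrite linearZ /= h.
Qed.

Section Components.
Variables (dg : {linear g -> tensor g g}) (dV : {linear V -> tensor V V}).
Variable D : 'I_d -> {linear g -> g}.
Local Notation delta := (star t dg dV D).

Lemma star_fst : colie_hom delta dg fst.
Proof.
move=> u; rewrite /= /star !tens_map_add !tens_map_comp.
rewrite [X in _ + X]tens_map0l // addr0 tens_map_scale tens_map_sum.
rewrite big1 => [|i _]; last by rewrite /= wedge_map /= wedge0r.
by rewrite scaler0 addr0 tens_map_id.
Qed.

Lemma star_snd : colie_hom delta dV snd.
Proof.
move=> u; rewrite /= /star !tens_map_add !tens_map_comp.
rewrite [X in X + _ + _]tens_map0l // add0r tens_map_scale tens_map_sum.
rewrite big1 => [|i _]; last by rewrite /= wedge_map /= wedge0l.
by rewrite scaler0 add0r tens_map_id.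
Qed.

(** The factor 2 of (star) cancels the one half in the wedge. *)
Lemma star_mixed (f : 'Hom(V, K^o)) :
  contracts_to fst snd delta f (dual_interp D f).
Proof.
move=> u; rewrite /= /star !tens_map_add !contract_r_add !tens_map_comp.
rewrite [tens_map (fst \o in_V) _ _]tens_map0l // contract_r_zero addr0.
rewrite [tens_map _ (snd \o in_g) _]tens_map0r // contract_r_zero add0r.
rewrite tens_map_scale contract_r_scale tens_map_sum contract_r_sum.
rewrite scaler_sumr; apply: eq_bigr => i _.
rewrite -contract_r_scale -tens_map_scale.
rewrite double_wedge // tens_map_sub !tens_mapE /= linear0.
by rewrite subr0 contract_rE.
Qed.

Lemma star_antisym :
  (forall x, Lambda2 g (dg x)) -> (forall v, Lambda2 V (dV v)) ->
  forall u, tens_swap (delta u) = - delta u.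
Proof.
move=> lg lV u; rewrite /= /star !tens_swap_add !tens_swap_map.
have /Lambda2P -> // := lg u.1; have /Lambda2P -> // := lV u.2.
rewrite !tens_map_opp !opprD.
congr (_ + _ + _); rewrite tens_swap_scale.
rewrite tens_swap_sum -scalerN -sumrN; congr (_ *: _).
by apply: eq_bigr => i _; exact: swap_wedge.
Qed.

(** Each axiom is checked component by component: the components of the
    cojacobiator and of the cocycle defect vanish by the conditions on the
    data. *)
Lemma star_bialgebra : star_data br t dg dV D -> is_lie_bialgebra brL delta.
Proof.
case=> [[_ [lg jg] cg] [lV jV] [DD [DDb DDbr] DDt]].
have DDE := dual_interp_unique DDt.
have mix (f : 'Hom(V, K^o)) : contracts_to fst snd delta f (DD f).
  by rewrite DDE; exact: star_mixed.
have anti := star_antisym lg lV.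
split; first exact: prod_bracket_lie.
  split=> u; first exact/(Lambda2P charK)/anti.
  rewrite -[LHS]/(cojacobiator delta u).
  apply: (cyclic_prod_eq0 basis_t); first exact: cyc_Alt.
  - by rewrite -(cojacobiator_hom _ star_fst) /cojacobiator jg.
  - by rewrite -(cojacobiator_hom _ star_snd) /cojacobiator jV.
  - move=> i; have [D' [_ cD'] eD'] := DDb (dual_basis t i).
    rewrite (@cojacobiator_ggV _ _ _ _ _ _ _ anti dg _ D') //.
    + by rewrite -cD' subrr scaler0.
    + exact: star_fst.
    + by rewrite eD'.
  move=> i j; have [Di _ eDi] := DDb (dual_basis t i).
  have [Dj _ eDj] := DDb (dual_basis t j).
  have [Dk _ eDk] := DDb (dual_bracket dV (dual_basis t i) (dual_basis t j)).
  rewrite (@cojacobiator_gVV _ _ _ _ _ _ _ anti dV _ _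
    (dual_bracket dV (dual_basis t i) (dual_basis t j)) Di Dj Dk) //.
  - by rewrite eDk eDi eDj DDbr /commutator subrr scaler0.
  - exact: star_snd.
  - by rewrite eDi.
  - by rewrite eDj.
  - by rewrite eDk.
  - by move=> v; exact: dual_bracketE.
move=> u w; apply/eqP; rewrite -subr_eq0; apply/eqP.
apply: (antisym_prod_eq0 basis_t charK).
- by rewrite !tens_swap_sub !swap_ad2 !anti !ad2_opp -!opprD.
- rewrite !tens_map_sub !(ad2_map _ _ (@lie_hom_fst _ _ br V)) -!star_fst /=.
  by rewrite cg subrr.
- by rewrite !tens_map_sub !snd_ad2 -star_snd /= linear0 !subr0.
move=> i; have [D' [dD _] eD'] := DDb (dual_basis t i).
rewrite !tens_map_sub !contract_r_sub !contract_ad2 !mix -eD' dD.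
by rewrite (lie_bracket_anti (D' _) _ lie_g) opprB addrACA addNr subrr addr0.
Qed.

(** The cobrackets of [g] and [V] are images of [delta] under the projections;
    the conditions on [D] are the mixed components of the axioms, freed from
    the factor 2 by the characteristic. *)
Lemma star_bialgebra_data :
  is_lie_bialgebra brL delta -> star_data br t dg dV D.
Proof.
move=> bi; have [_ [lL jL] cL] := bi.
have anti u : tens_swap (delta u) = - delta u by exact/(Lambda2P charK)/lL.
have mix (f : 'Hom(V, K^o)) :
  contracts_to fst snd delta f (dual_interp_at D f) := star_mixed f.
split.
- exact: (@bialgebra_image K charK L g fst (@fst_surj K g V) delta dg star_fst
    brL br (@lie_hom_fst K g br V) bi).
- apply: (@coalgebra_image K charK L V snd (@snd_surj K g V) delta dV star_snd).
  by split.
exists (dual_interp D); last exact: dual_interp_basis.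
split=> [f|f h].
  exists (dual_interp_at D f) => //; split=> [x y|x].
    have := congr1 (fun s => contract_r f (tens_map fst snd s))
      (cL (in_g x) (in_g y)).
    rewrite tens_map_sub contract_r_sub !contract_ad2 !mix /= => ->.
    by rewrite (lie_bracket_anti y _ lie_g) opprK addrC.
  have := @cojacobiator_ggV K _ _ _ fst snd _ anti dg f (dual_interp_at D f)
    (in_g x) star_fst (mix f).
  rewrite /cojacobiator jL tens_map_zero contract_r_zero.
  move=> /esym/(scale2_eq0 charK)/eqP.
  by rewrite subr_eq0 => /eqP.
apply/funext => x.
have := @cojacobiator_gVV K _ _ _ fst snd _ anti dV f h (dual_bracket dV f h)
  (dual_interp_at D f) (dual_interp_at D h)
  (dual_interp_at D (dual_bracket dV f h)) (in_g x) star_snd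
  (mix f) (mix h) (mix _) (fun v => dual_bracketE dV f h v).
rewrite /cojacobiator jL tens_map_zero !contract_r_zero.
move=> /esym/(scale2_eq0 charK)/eqP.
by rewrite subr_eq0 => /eqP.
Qed.

End Components.
End StarStructure.

(** * Every cobracket has the form (star) *)

Lemma antisym_dim1 (K : fieldType) (V : vectType K) (t : 1.-tuple V)
    (s : tensor V V) :
  [pchar K] =i pred0 -> basis_of fullv t -> tens_swap s = - s -> s = 0.
Proof.
move=> charK bt sw.
have sE : tens_swap s = s.
  apply: (tens_ext (f := @tens_swap _ _ _) (h := idfun)) => x y /=.
  rewrite tens_swapE (dual_basis_sum bt x) (dual_basis_sum bt y) !big_ord1.
  by rewrite !(linearZl_LR, linearZ) /= scalerA mulrC -scalerA -linearZl_LR.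
apply: (scale2_eq0 charK); rewrite scaler_nat mulr2n -{1}sE sw.
by rewrite addNr.
Qed.

Section ProductBialgebra.
Variable K : fieldType.
Hypothesis charK : [pchar K] =i pred0.
Variables (g : lmodType K) (br : {bilinear g -> g -> g}).
Hypothesis lie_g : is_lie_bracket br.
Variable V : vectType K.
Local Notation L := (g * V)%type.
Local Notation in_g := (@in_l K g V).
Local Notation in_V := (@in_r K g V).
Local Notation brL := (prod_bracket br).

Variable delta : {linear L -> tensor L L}.
Hypothesis bi : is_lie_bialgebra brL delta.

Definition mixed_component (f : {linear V -> K^o}) : g -> g :=
  contract_r f \o (tens_map fst snd \o (delta \o in_g)).
HB.instance Definition _ f := GRing.Linear.on (mixed_component f).

Lemma delta_anti u : tens_swap (delta u) = - delta u.
Proof. by case: bi => _ [lL _] _; exact/(Lambda2P charK)/lL. Qed.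

(** In the cocycle identity for [u] and [v], the bracket and the adjoint action
    of [v] vanish because [V] is central. *)
Lemma delta_V_invariant v u : ad2 brL u (delta (in_V v)) = 0.
Proof.
case: bi => _ _ cL; have := cL u (in_V v).
have z w : brL (in_V v) w = 0 by rewrite /prod_bracket /= linear0l.
rewrite {2}/ad2 tens_map0l // tens_map0r // addr0 subr0 => <-.
rewrite -[RHS](linear0 delta); congr (delta _).
by rewrite /= /prod_bracket /= linear0.
Qed.

Section Components.
Variables (d : nat) (t : d.-tuple V).
Hypothesis basis_t : basis_of fullv t.
Hypothesis inv_g : Lambda2_invariants br = [set 0].
Hypothesis center_g : center br = [set 0].

(** By invariance, the part of [delta v] in [g (x) g] is an invariant of the
    exterior square, and the contractions of its part in [g (x) V] commute with
    [g]: the two hypotheses on [g] leave only the part in [V (x) V]. *)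
Lemma delta_in_V v :
  delta (in_V v) = tens_map in_V in_V (cobracket_r delta v).
Proof.
rewrite (antisym_prod_decomp basis_t charK (delta_anti (in_V v))).
have -> : tens_map fst fst (delta (in_V v)) = 0.
  suff : Lambda2_invariants br (tens_map fst fst (delta (in_V v))).
    by rewrite inv_g.
  split.
    apply/(Lambda2P charK).
    by rewrite tens_swap_map delta_anti tens_map_opp.
  move=> x; rewrite -[x]/(fst (in_g x)) -(ad2_map _ _ (@lie_hom_fst _ _ br V)).
  by rewrite delta_V_invariant tens_map_zero.
rewrite tens_map_zero add0r big1 => [|i _]; last first.
  set x := contract_r _ _; suff -> : x = 0 by rewrite linear0 wedge0l.
  suff : center br x by rewrite center_g.
  move=> y; rewrite (lie_bracket_anti _ _ lie_g) -[y]/(fst (in_g y)).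
  rewrite -contract_ad2 delta_V_invariant.
  by rewrite tens_map_zero contract_r_zero oppr0.
by rewrite scaler0 add0r.
Qed.

Hypothesis perfect_or_dim1 : derived br = setT \/ d = 1%N.

(** The adjoint action of [L] takes values in tensors with a factor in [g], so
    by the cocycle identity the [V (x) V] part of [delta] kills brackets. *)
Lemma delta_in_g_VV x : tens_map snd snd (delta (in_g x)) = 0.
Proof.
case: perfect_or_dim1 => [dg|d1].
  have : derived br x by rewrite dg.
  apply: (eq0_lspan (f := tens_map snd snd \o (delta \o in_g))).
  move=> _ [y _ [z _ <-]] /=.
  case: bi => _ _ cL; have := cL (in_g y) (in_g z).
  rewrite /= /prod_bracket /= => ->.
  by rewrite tens_map_sub !snd_ad2 subrr.
move: (t) basis_t; rewrite d1 => t1 b1; apply: (antisym_dim1 charK b1).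
by rewrite tens_swap_map delta_anti tens_map_opp.
Qed.

Lemma delta_in_g x : delta (in_g x) =
  tens_map in_g in_g (cobracket_l delta x) +
  2%:R *: \sum_i wedge (in_g (mixed_component (dual_basis t i) x))
                       (in_V (tnth t i)).
Proof.
rewrite {1}(antisym_prod_decomp basis_t charK (delta_anti (in_g x))).
by rewrite delta_in_g_VV tens_map_zero addr0.
Qed.

Lemma delta_star : delta =1
  star t (cobracket_l delta) (cobracket_r delta)
         (fun i => mixed_component (dual_basis t i)).
Proof.
move=> [x v]; have -> : (x, v) = in_g x + in_V v.
  by congr (_, _); rewrite /= ?addr0 ?add0r.
by rewrite linearD /= delta_in_g delta_in_V /star /= addr0 add0r.
Qed.

Lemma delta_star_data :
  star_data br t (cobracket_l delta) (cobracket_r delta)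
         (fun i => mixed_component (dual_basis t i)).
Proof.
apply: star_bialgebra_data => //.
exact: (bialgebra_eq charK delta_star).
Qed.

End Components.
End ProductBialgebra.

(** * Transport along automorphisms *)

Section Transport.
Variables (K : fieldType) (g : lmodType K) (V : vectType K).
Variables (d : nat) (t : d.-tuple V).
Local Notation L := (g * V)%type.
Local Notation in_g := (@in_l K g V).
Local Notation in_V := (@in_r K g V).
Variables (dg : {linear g -> tensor g g}) (dV : {linear V -> tensor V V}).
Variable D : 'I_d -> {linear g -> g}.
Variables (phig phig' : {linear g -> g}) (phiV phiV' : {linear V -> V}).
Variable A : 'M[K]_d.
Hypotheses (phigK : cancel phig phig') (phiVK : cancel phiV phiV').
Hypothesis phiVA : forall j, phiV (tnth t j) = \sum_(i < d) A i j *: tnth t i.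

Lemma star_transport :
  colie_hom (star t dg dV D)
    (star t (transport phig phig' dg) (transport phiV phiV' dV)
       (fun i => transport_D A phig phig' D i))
    (prod_map phig phiV).
Proof.
move=> u; rewrite /= /star /= !tens_map_add !tens_map_comp phigK phiVK.
congr (_ + _ + _).
- by apply: eq_tens_map => x;
    congr (_, _); rewrite /= linear0.
- rewrite tens_map_scale tens_map_sum; congr (_ *: _).
  under [RHS]eq_bigr => j _.
    rewrite wedge_map /=.
    have -> : prod_map phig phiV (in_g (D j u.1)) = in_g (phig (D j u.1)).
      by congr (_, _); rewrite /= linear0.
    have -> : prod_map phig phiV (in_V (tnth t j)) =
        \sum_i A i j *: in_V (tnth t i).
      rewrite -[RHS](eq_bigr _ (fun i _ => linearZ_LR in_V _ _)) /= -linear_sum.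
      by rewrite -phiVA; congr (_, _); rewrite /= linear0.
    rewrite wedge_sumr; over.
  rewrite exchange_big; apply: eq_bigr => i _.
  rewrite /transport_D linear_sum wedge_suml; apply: eq_bigr => j _ /=.
  by rewrite phigK linearZ /= wedgeZl wedgeZr.
by apply: eq_tens_map => x;
    congr (_, _); rewrite /= linear0.
Qed.

End Transport.

Section LieAutomorphisms.
Variables (K : fieldType) (g : lmodType K) (br : {bilinear g -> g -> g}).
Variable V : lmodType K.
Hypothesis center_g : center br = [set 0].
Hypothesis perfect_g : derived br = setT.
Local Notation L := (g * V)%type.
Local Notation in_g := (@in_l K g V).
Local Notation in_V := (@in_r K g V).
Local Notation brL := (prod_bracket br).
Variables Phi Psi : {linear L -> L}.
Hypothesis PhiK : cancel Psi Phi.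
Hypothesis Phi_hom : lie_hom brL brL Phi.

(** A surjective homomorphism maps the center to the center, and the center of
    [L] is [V]. *)
Lemma lie_auto_in_V v : Phi (in_V v) = in_V (Phi (in_V v)).2.
Proof.
suff e : (Phi (in_V v)).1 = 0 by rewrite [LHS]surjective_pairing e.
suff : center br (Phi (in_V v)).1 by rewrite center_g.
move=> y; have := Phi_hom (in_V v) (Psi (in_g y)); rewrite PhiK => e.
have z w : brL (in_V v) w = 0 by rewrite /prod_bracket /= linear0l.
have := etrans (esym e) (congr1 Phi (z _)); rewrite linear0.
by move=> /(congr1 fst).
Qed.

(** A homomorphism preserves the derived algebra, and the derived algebra of
    [L] is [g]. *)
Lemma lie_auto_in_g x : Phi (in_g x) = in_g (Phi (in_g x)).1.
Proof.
suff e : (Phi (in_g x)).2 = 0 by rewrite [LHS]surjective_pairing e.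
have : derived br x by rewrite perfect_g.
apply: (eq0_lspan (f := snd \o (Phi \o in_g))) => _ [y _ [z _ <-]] /=.
by have := Phi_hom (in_g y) (in_g z); rewrite /= /prod_bracket /= => ->.
Qed.

Lemma lie_auto_diag :
  Phi =1 prod_map (fst \o (Phi \o in_g)) (snd \o (Phi \o in_V)).
Proof.
move=> [x v]; have -> : (x, v) = in_g x + in_V v.
  by congr (_, _); rewrite /= ?addr0 ?add0r.
rewrite linearD lie_auto_in_g lie_auto_in_V /=.
by congr (_, _); rewrite /= ?addr0 ?add0r.
Qed.

End LieAutomorphisms.

(** * The quotient by V *)

Section Quotient.
Variable K : fieldType.
Hypothesis charK : [pchar K] =i pred0.
Variables (g V : lmodType K) (br : {bilinear g -> g -> g}).
Local Notation L := (g * V)%type.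
Local Notation in_g := (@in_l K g V).
Local Notation in_V := (@in_r K g V).
Local Notation brL := (prod_bracket br).
Local Notation Q := (quotmod (@sub_r_submod K g V)).
Local Notation pi := (@quotmod_pi K L (@sub_r_submod K g V)).

Definition quot_fst (z : Q) : g := (projT1 (cid (quotmod_ex z))).1.

Lemma quot_fst_pi u : quot_fst (pi u) = u.1.
Proof.
rewrite /quot_fst; case: cid => w /= /quotmod_piP.
rewrite -sub_rP => -[v _ /(congr1 fst) /= /esym/eqP].
by rewrite subr_eq0 => /eqP.
Qed.

Lemma quot_fst_linear : linear quot_fst.
Proof.
move=> a z w; have [u ->] := quotmod_ex z; have [u' ->] := quotmod_ex w.
by rewrite -linearP !quot_fst_pi.
Qed.

HB.instance Definition _ := GRing.isLinear.Build K Q g _ quot_fst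
  quot_fst_linear.

Lemma pi_in_g u : pi (in_g u.1) = pi u.
Proof.
by apply/quotmod_piP/sub_rP; exists (- u.2) => //; congr (_, _);
  rewrite /= ?subrr ?sub0r.
Qed.

Definition quot_bracket (z w : Q) : Q :=
  pi (in_g (br (quot_fst z) (quot_fst w))).

Lemma quot_bracket_bilinear : bilinear_for *:%R *:%R quot_bracket.
Proof.
split=> [w a z z'|z a w w'] /=; rewrite /quot_bracket.
  by rewrite linearP linearPl !linearP.
by rewrite !linearP.
Qed.

HB.instance Definition _ := bilinear_isBilinear.Build K Q Q Q _ _ quot_bracket
  quot_bracket_bilinear.

Variables (delta : {linear L -> tensor L L}) (dg : {linear g -> tensor g g}).
Hypothesis fst_hom : colie_hom delta dg fst.
Hypothesis bi : is_lie_bialgebra br dg.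

Definition quot_cobracket : Q -> tensor Q Q :=
  transport (pi \o in_g) quot_fst dg.
HB.instance Definition _ := GRing.Linear.on quot_cobracket.

Lemma quot_bialgebra : is_lie_bialgebra quot_bracket quot_cobracket.
Proof.
apply: (bialgebra_image charK (f := pi \o in_g)) bi.
- move=> z; have [u ->] := quotmod_ex z; exists u.1.
  by rewrite /= pi_in_g.
- move=> x; rewrite /= /quot_cobracket /transport /=.
  by rewrite quot_fst_pi.
by move=> x y; rewrite /= /quot_bracket /= !quot_fst_pi.
Qed.

Lemma quot_pi_hom : bialg_hom brL delta quot_bracket quot_cobracket pi.
Proof.
split=> [u w|u]; first by rewrite /= /quot_bracket !quot_fst_pi.
rewrite /= /quot_cobracket /transport /= quot_fst_pi fst_hom tens_map_comp.
by apply: eq_tens_map => w /=; rewrite pi_in_g.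
Qed.

Lemma quot_unique (b b' : {bilinear Q -> Q -> Q})
    (c c' : {linear Q -> tensor Q Q}) :
  bialg_hom brL delta b c pi -> bialg_hom brL delta b' c' pi ->
  b' =2 b /\ c' =1 c.
Proof.
move=> [hb hc] [hb' hc']; split=> [z w|z]; have [u ->] := quotmod_ex z.
  by have [u' ->] := quotmod_ex w; rewrite -hb -hb'.
by rewrite hc hc'.
Qed.

Lemma quot_iso (b : {bilinear Q -> Q -> Q}) (c : {linear Q -> tensor Q Q}) :
  bialg_hom brL delta b c pi -> bialg_iso b c br dg quot_fst.
Proof.
move=> [hb hc]; split; last split.
- exists (pi \o in_g) => [z|x]; last by rewrite /= quot_fst_pi.
  by have [u ->] := quotmod_ex z; rewrite /= quot_fst_pi pi_in_g.
- move=> z w; have [u ->] := quotmod_ex z; have [u' ->] := quotmod_ex w.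
  by rewrite -hb /= !quot_fst_pi.
move=> z; have [u ->] := quotmod_ex z; rewrite /= quot_fst_pi fst_hom hc.
by rewrite tens_map_comp; apply: eq_tens_map => w; exact/esym/quot_fst_pi.
Qed.

End Quotient.

(** * The subalgebra of biderivations *)

Section BiderivationAlgebra.
Variables (K : fieldType) (g : lmodType K) (br : {bilinear g -> g -> g}).
Variables (V : vectType K) (d : nat) (t : d.-tuple V).
Hypothesis basis_t : basis_of fullv t.
Variables (dg : {linear g -> tensor g g}) (dV : {linear V -> tensor V V}).
Variable D : 'I_d -> {linear g -> g}.
Variable DD : {linear 'Hom(V, K^o) -> (g -> g)}.
Hypothesis DD_lie : lie_map_to_BiDer br dg dV DD.
Hypothesis DD_basis : forall i, DD (dual_basis t i) = D i :> (g -> g).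

Lemma lspan_dual_image (E : g -> g) :
  lspan (range (fun i : 'I_d => D i : g -> g)) E <-> exists f, E = DD f.
Proof.
split=> [[n [c [u [uD ->]]]]|[f ->]].
  apply: (big_ind (fun E => exists f, E = DD f)) => [|_ _ [f ->] [h ->]|k _].
  - by exists 0; rewrite linear0.
  - by exists (f + h); rewrite linearD.
  have [i _ <-] := uD k; exists (c k *: dual_basis t i).
  by rewrite linearZ /= DD_basis.
rewrite (dual_basis_expand basis_t f) linear_sum; apply: lspan_sum => i _.
by rewrite linearZ /= DD_basis; apply/lspanZ/lspan_gen; exists i.
Qed.

(** The span is the image of the Lie algebra map [DD]. *)
Lemma lspan_BiDer_subalgebra :
  lie_subalgebra_of (BiDer br dg)
    (lspan (range (fun i : 'I_d => D i : g -> g))).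
Proof.
case: DD_lie => DDb DDc; split.
- by move=> E /lspan_dual_image [f ->].
- by move=> E; apply: (lspan_min (f := idfun)).
move=> E F /lspan_dual_image [f ->] /lspan_dual_image [h ->].
by rewrite -DDc; apply/lspan_dual_image; exists (dual_bracket dV f h).
Qed.

End BiderivationAlgebra.

(** * The classification *)

Theorem theorem3p3 (K : fieldType) (charK : [pchar K] =i pred0)
    (g : lmodType K) (br : {bilinear g -> g -> g}) (lie_g : is_lie_bracket br)
    (inv_g : Lambda2_invariants br = [set 0]) (center_g : center br = [set 0])
    (V : vectType K) (d : nat) (dimV : \dim (fullv : {vspace V}) = d)
    (d_gt0 : (0 < d)%N)
    (hyp : ((1 < d)%N /\ derived br = setT) \/ d = 1%N) :
  let L : lmodType K := (g * V)%type in
  let brL : {bilinear L -> L -> L} := prod_bracket br in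
  let gL : set L := @sub_l K g V in
  let VL : set L := @sub_r K g V in
  let LmodV : lmodType K := quotmod (@sub_r_submod K g V) in
  let pi : {linear L -> LmodV} := @quotmod_pi K L (@sub_r_submod K g V) in
  let incl_g : {linear g -> L} := @in_l K g V in
  let incl_V : {linear V -> L} := @in_r K g V in
  (* Lie cobrackets on L *)
  (forall delta : {linear L -> tensor L L}, is_lie_bialgebra brL delta ->
    let dg : {linear g -> tensor g g} := cobracket_l delta in
    let dV : {linear V -> tensor V V} := cobracket_r delta in
    [/\ (* delta is of the form (star) *)
        forall t : d.-tuple V, basis_of fullv t ->
          exists dg' dV' D, star_data br t dg' dV' D /\
            delta =1 star t dg' dV' D,
        (* 1 *)
        [/\ forall u, VL u -> wedge_sub VL VL (delta u),
            is_lie_coalgebra dV /\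
              (forall v, delta (incl_V v) = tens_map incl_V incl_V (dV v)),
            lie_ideal brL VL,
            coideal delta VL &
            exists (brQ : {bilinear LmodV -> LmodV -> LmodV})
                   (dQ : {linear LmodV -> tensor LmodV LmodV}),
              [/\ is_lie_bialgebra brQ dQ,
                  bialg_hom brL delta brQ dQ pi &
                  forall (brQ' : {bilinear LmodV -> LmodV -> LmodV})
                         (dQ' : {linear LmodV -> tensor LmodV LmodV}),
                    is_lie_bialgebra brQ' dQ' ->
                    bialg_hom brL delta brQ' dQ' pi ->
                    brQ' =2 brQ /\ dQ' =1 dQ]],
        (* 2 *)
        is_lie_bialgebra br dg /\
        (forall (brQ : {bilinear LmodV -> LmodV -> LmodV})
                (dQ : {linear LmodV -> tensor LmodV LmodV}),
           is_lie_bialgebra brQ dQ -> bialg_hom brL delta brQ dQ pi ->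
           exists2 f : {linear LmodV -> g}, bialg_iso brQ dQ br dg f &
             forall u, f (pi u) = u.1) &
        (* 3 *)
        (forall x, exists a b,
           [/\ wedge_sub gL gL a, wedge_sub gL VL b &
               delta (incl_g x) = a + b]) /\
        (forall t : d.-tuple V, basis_of fullv t ->
           exists D : 'I_d -> {linear g -> g},
           [/\ forall x, delta (incl_g x) = tens_map incl_g incl_g (dg x) +
                 2%:R *: (\sum_(i < d)
                            wedge (incl_g (D i x)) (incl_V (tnth t i))),
               forall i, derivation br (D i) /\ coderivation dg (D i),
               lie_subalgebra_of (BiDer br dg)
                 (lspan (range (fun i : 'I_d => D i : g -> g))) &
               exists2 DD : {linear 'Hom(V, K^o) -> (g -> g)},
                 lie_map_to_BiDer br dg dV DD &
                 forall i, DD (dual_basis t i) = D i :> (g -> g)])])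
  /\
  (* 4 *)
  (forall (t : d.-tuple V) (dg : {linear g -> tensor g g})
          (dV : {linear V -> tensor V V}) (D : 'I_d -> {linear g -> g})
          (phig phig' : {linear g -> g}) (phiV phiV' : {linear V -> V})
          (A : 'M[K]_d),
     basis_of fullv t -> star_data br t dg dV D ->
     cancel phig phig' -> cancel phig' phig -> lie_hom br br phig ->
     cancel phiV phiV' -> cancel phiV' phiV ->
     (forall j, phiV (tnth t j) = \sum_(i < d) A i j *: tnth t i) ->
     let dg1 : {linear g -> tensor g g} := transport phig phig' dg in
     let dV1 : {linear V -> tensor V V} := transport phiV phiV' dV in
     let D1 i : {linear g -> g} := transport_D A phig phig' D i in
     let delta : {linear L -> tensor L L} := star t dg dV D in
     let delta1 : {linear L -> tensor L L} := star t dg1 dV1 D1 in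
     [/\ is_lie_bialgebra brL delta,
         star_data br t dg1 dV1 D1,
         is_lie_bialgebra brL delta1 &
         bialg_iso brL delta brL delta1 (prod_map phig phiV)])
  /\
  (derived br = setT ->
   forall (delta delta1 : {linear L -> tensor L L}) (Phi : {linear L -> L}),
     is_lie_bialgebra brL delta -> is_lie_bialgebra brL delta1 ->
     bialg_iso brL delta brL delta1 Phi ->
     exists (phig phig' : {linear g -> g}) (phiV phiV' : {linear V -> V}),
     [/\ [/\ cancel phig phig', cancel phig' phig & lie_hom br br phig],
         cancel phiV phiV' /\ cancel phiV' phiV,
         Phi =1 prod_map phig phiV &
         forall (t : d.-tuple V) (dg : {linear g -> tensor g g})
                (dV : {linear V -> tensor V V}) (D : 'I_d -> {linear g -> g})
                (A : 'M[K]_d),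
           basis_of fullv t -> star_data br t dg dV D ->
           delta =1 star t dg dV D ->
           (forall j, phiV (tnth t j) = \sum_(i < d) A i j *: tnth t i) ->
           delta1 =1 star t (transport phig phig' dg)
                       (transport phiV phiV' dV)
                       (fun i => transport_D A phig phig' D i)]).
Proof.
move=> L brL gL VL LmodV pi incl_g incl_V.
have perfect_or_dim1 : derived br = setT \/ d = 1%N.
  by case: hyp => [[_ h]|h]; [left|right].
have [t0 basis_t0] : exists t : d.-tuple V, basis_of fullv t.
  by rewrite -dimV; exists (vbasis fullv); exact: vbasisP.
split; [|split].
- move=> delta bi dg dV.
  have starD (t : d.-tuple V) (bt : basis_of fullv t) :=
    delta_star_data charK lie_g bi bt inv_g center_g perfect_or_dim1.
  have starE (t : d.-tuple V) (bt : basis_of fullv t) :=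
    delta_star charK lie_g bi bt inv_g center_g perfect_or_dim1.
  have in_VE v := delta_in_V charK lie_g bi basis_t0 inv_g center_g v.
  have in_gE (t : d.-tuple V) (bt : basis_of fullv t) :=
    delta_in_g charK bi bt perfect_or_dim1.
  have [dg_bi dV_co _] := starD _ basis_t0.
  have fst_hom : colie_hom delta dg fst.
    by move=> u; rewrite (starE _ basis_t0); exact: star_fst.
  split.
  + move=> t bt.
    exists dg, dV, (fun i => mixed_component delta (dual_basis t i)).
    by split; [exact: starD|exact: starE].
  + split.
    * move=> _ [v _ <-]; rewrite in_VE.
      by apply: wedge_sub_map (dV_co.1 v) => x _; exists x.
    * exact: (conj dV_co in_VE).
    * move=> u _ [v _ <-]; exists 0 => //; congr (_, _).
      by rewrite /= linear0.
    * move=> _ [v _ <-]; rewrite in_VE.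
      by apply: wedge_sub_map (dV_co.1 v) => x _ //; exists x.
    exists (quot_bracket br), (quot_cobracket dg).
    have pi_hom := quot_pi_hom br fst_hom.
    split; [exact: quot_bialgebra|exact: pi_hom|].
    by move=> b c _ hb; apply: quot_unique hb.
  + split=> // b c _ hb; exists (@quot_fst K g V); first exact: quot_iso hb.
    exact: quot_fst_pi.
  split=> [x|t bt].
    exists (tens_map incl_g incl_g (dg x)), (2%:R *: (\sum_i
      wedge (incl_g (mixed_component delta (dual_basis t0 i) x))
            (incl_V (tnth t0 i)))).
    split; last exact: (in_gE _ basis_t0).
      have [_ [lg _] _] := dg_bi.
      by apply: wedge_sub_map (lg x) => y _; exists y.
    apply/lspanZ/lspan_sum => i _; apply: lspan_gen.
    by eexists; last eexists; [eexists|eexists|].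
  have [_ _ [DD DDl DDb]] := starD _ bt.
  exists (fun i => mixed_component delta (dual_basis t i)); split.
  + exact: in_gE.
  + move=> i; have [D' [derD' coderD'] D'E] := DDl.1 (dual_basis t i).
    have e x : mixed_component delta (dual_basis t i) x = D' x.
      by rewrite D'E DDb.
    split=> [x y|x]; first by rewrite /= !e derD'.
    by rewrite /= e -coderD'; congr (_ + _); apply: eq_tens_map.
  + exact: (lspan_BiDer_subalgebra bt DDl DDb).
  by exists DD.
- move=> t dg dV D phig phig' phiV phiV' A bt data.
  move=> phigK phigK' phig_hom phiVK phiVK' phiVA dg1 dV1 D1 delta delta1.
  have bi : is_lie_bialgebra brL delta by exact: star_bialgebra.
  have Phi_co : colie_hom delta delta1 (prod_map phig phiV).
    exact: star_transport.
  have Phi_hom : lie_hom brL brL (prod_map phig phiV).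
    move=> u w; congr (_, _); first exact: phig_hom.
    exact: linear0.
  have bi1 : is_lie_bialgebra brL delta1.
    apply: (bialgebra_image charK (f := prod_map phig phiV)) bi => //.
    move=> [x v]; exists (phig' x, phiV' v).
    by congr (_, _); rewrite /= ?phigK' ?phiVK'.
  (* The transported data satisfy the conditions on data because [delta1] is
     now known to be a Lie bialgebra structure. *)
  split=> //; first exact: star_bialgebra_data bi1.
  split=> //; exists (prod_map phig' phiV') => -[x v].
    by congr (_, _); rewrite /= ?phigK ?phiVK.
  by congr (_, _); rewrite /= ?phigK' ?phiVK'.
move=> perfect_g delta delta1 Phi bi bi1 [[Psi0 PhiK0 PsiK0] [Phi_hom Phi_co]].
pose Psi : {linear L -> L} := HB.pack Psi0
  (GRing.isLinear.Build K L L _ Psi0 (can2_linear PhiK0 PsiK0)).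
have PhiK : cancel Phi Psi := PhiK0; have PsiK : cancel Psi Phi := PsiK0.
have Psi_hom : lie_hom brL brL Psi.
  by move=> u w; rewrite -{1}[u]PsiK -{1}[w]PsiK -Phi_hom PhiK.
have Phi_diag := lie_auto_diag center_g perfect_g (Psi := Psi) PsiK Phi_hom.
have Psi_diag := lie_auto_diag center_g perfect_g (Psi := Phi) PhiK Psi_hom.
pose phig : {linear g -> g} := fst \o (Phi \o incl_g).
pose phig' : {linear g -> g} := fst \o (Psi \o incl_g).
pose phiV : {linear V -> V} := snd \o (Phi \o incl_V).
pose phiV' : {linear V -> V} := snd \o (Psi \o incl_V).
have diagK u : prod_map phig' phiV' (prod_map phig phiV u) = u.
  by rewrite -Phi_diag -Psi_diag; exact: PhiK.
have diagK' u : prod_map phig phiV (prod_map phig' phiV' u) = u.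
  by rewrite -Psi_diag -Phi_diag; exact: PsiK.
have phigK x : phig' (phig x) = x by have /(congr1 fst) := diagK (x, 0).
have phigK' x : phig (phig' x) = x by have /(congr1 fst) := diagK' (x, 0).
have phiVK v : phiV' (phiV v) = v by have /(congr1 snd) := diagK (0, v).
have phiVK' v : phiV (phiV' v) = v by have /(congr1 snd) := diagK' (0, v).
exists phig, phig', phiV, phiV'; split=> //.
  by split=> // x y; have /(congr1 fst) := Phi_hom (incl_g x) (incl_g y).
move=> t dg dV D A bt _ deltaE phiVA u.
(* Both cobrackets are compared at a point of the image of Phi, where they are
   the images of [delta]. *)
rewrite -[u]diagK'; set w := prod_map phig' phiV' u.
rewrite [RHS](star_transport dg dV D phigK phiVK phiVA) -Phi_diag Phi_co.
rewrite deltaE /=.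
by apply: eq_tens_map; exact: Phi_diag.
Qed.
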